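(* Let $m\in\mathbb{N}=\{1,2,3,\dots\}$, $\mathcal{A}=\{1,\dots,m\}$, and for each $i\in\mathcal{A}$ let $S^i=\{s^i_0,\dots,s^i_{n_i}\}$ be a set with $n_i+1$ elements, $n_i\in\mathbb{N}$. Let $S=S^1\times\dots\times S^m$ and let $\mathcal{U}=(\mathbb{R}^S)^m$ be the real vector space of all tuples $U=(U^1,\dots,U^m)$ of utility functions $U^i:S\to\mathbb{R}$. Then there is a semialgebraic subset $\mathcal{D}\subset\mathcal{U}$ of codimension at least one (equivalently, of Lebesgue measure $0$) such that for any $U\in\mathcal{U}-\mathcal{D}$ the following holds. The hyperplanes $H^{i,j}$, $i\in\mathcal{A}$, $j\in J^i_0\cup\{\infty\}$, and the subvarieties $H^{i,(j,k)}$, $i\in\mathcal{A}$, $(j,k)\in J^{i,2}_0$ (all defined in the context; the latter depend on $U$), are smooth hypersurfaces in $\mathbb{P}^{\mathcal{A}}W$. Moreover, any good subset of them is everywhere transversal; that is, for all sets $T^i\subset J^i_0\cup\{\infty\}$ and $R^i\subset J^{i,2}_0$ ($i\in\mathcal{A}$) such that for each $i\in\mathcal{A}$ the graph $(J^i_0,R^i)$ is a union of trees, the family $$\bigcup_{i\in\mathcal{A}}\Bigl(\{H^{i,j}\mid j\in T^i\}\cup\{H^{i,(j,k)}\mid (j,k)\in R^i\}\Bigr)$$ is everywhere transversal in $\mathbb{P}^{\mathcal{A}}W$.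
   Context: Index sets: $J^i:=\{1,\dots,n_i\}$, $J^i_0:=\{0\}\cup J^i$, $J_0^{\mathcal{A}}:=\prod_{i=1}^m J^i_0$, $J^{i,2}_0:=\{(j,k)\in J^i_0\times J^i_0\mid j<k\}$. Spaces: $W^i:=\bigoplus_{j=0}^{n_i}\mathbb{R}\, s^i_j$ with linear coordinates $(\gamma^i_0,\dots,\gamma^i_{n_i})$, $W:=W^1\times\dots\times W^m$; $A^i:=\{\sum_j\gamma^i_js^i_j\in W^i\mid\sum_{j=0}^{n_i}\gamma^i_j=1\}$, $A:=A^1\times\dots\times A^m$. On $A^i$ the tuple $\underline{\gamma}^i=(\gamma^i_1,\dots,\gamma^i_{n_i})$ is a system of affine coordinates (with $\gamma^i_0=1-\sum_{j=1}^{n_i}\gamma^i_j$), and $\underline{\gamma}^{-i}$ denotes the tuple of all $\underline{\gamma}^l$ with $l\neq i$. Utility functions: for $U\in\mathcal{U}$ and $i\in\mathcal{A}$ let $V^i_W:W\to\mathbb{R}$ be the multilinear extension $$V^i_W(g)=\sum_{(j_1,\dots,j_m)\in J_0^{\mathcal{A}}}\Bigl(\prod_{k=1}^m\gamma^k_{j_k}\Bigr)U^i(s^1_{j_1},\dots,s^m_{j_m}),\quad g=(g^1,\dots,g^m),\ g^k=\sum_{j=0}^{n_k}\gamma^k_js^k_j,$$ and let $V^i_A$ be its restriction to $A$. It can be written uniquely as $V^i_A(g)=\kappa^i(\underline{\gamma}^{-i})+\sum_{j=1}^{n_i}\gamma^i_j\,\lambda^i_j(\underline{\gamma}^{-i})$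 with polynomials $\kappa^i,\lambda^i_j$ in $\underline{\gamma}^{-i}$; put $\lambda^i_0:=0$. The differences $\lambda^i_j-\lambda^i_k$ are regarded as functions on $A$ (not depending on the $i$-th factor). Compactification: $\mathbb{P}W^i=(W^i-\{0\})/\mathbb{R}^*$ is the real projective space of lines through $0$ in $W^i$, $\mathbb{P}^{\mathcal{A}}W:=\prod_{i=1}^m\mathbb{P}W^i$, $\mathbb{P}^{-i}W:=\prod_{l\in\mathcal{A}-\{i\}}\mathbb{P}W^l$, and $\mathbb{P}W^i\times\mathbb{P}^{-i}W$ is identified with $\mathbb{P}^{\mathcal{A}}W$. The sets $A^i$ and $A$ are embedded as Zariski open subsets in $\mathbb{P}W^i$ and $\mathbb{P}^{\mathcal{A}}W$ by sending a vector (in each factor) to the line it spans. $\overline{B}^{Zar}$ denotes the Zariski closure of a subset $B$, i.e. the smallest real algebraic subvariety (of $\mathbb{P}W^i$ respectively $\mathbb{P}^{\mathcal{A}}W$) containing $B$. For $i\in\mathcal{A}$ define $$H^{i,\infty}:=(\mathbb{P}W^i-A^i)\times\mathbb{P}^{-i}W,\qquad H^{i,j}:=\overline{\{g^i\in A^i\mid\gamma^i_j=0\}}^{Zar}\times\mathbb{P}^{-i}W\ \ (j\in J^i_0),$$ $$H^{i,(j,k)}:=\overline{(\lambda^i_j-\lambda^i_k)^{-1}(0)}^{Zar}\subset\mathbb{P}^{\mathcal{A}}W\ \ ((j,k)\in J^{i,2}_0).$$ Graphs: a set $R^i\subset J^{i,2}_0$ defines a graph with vertex set $J^i_0$ and edge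 set $R^i$; ''union of trees'' means that this graph is a forest (has no cycles). Smooth hypersurface: a $C^\infty$-submanifold of codimension one; the empty set is allowed. Transversality: let $M$ be a $C^\infty$-manifold and $H_1,\dots,H_a$ $C^\infty$-submanifolds. A defining map for a submanifold $H$ at $p\in H$ is a $C^\infty$-map $F:O\to\mathbb{R}^n$ on an open neighborhood $O\subset M$ of $p$ whose differential is surjective at each point of $O$ and with $H\cap O=F^{-1}(F(p))$. The family $H_1,\dots,H_a$ is transversal at $p\in M$ if either $p$ lies in no $H_i$, or, for those $H_{i_1},\dots,H_{i_r}$ which contain $p$, for some (equivalently, any) tuple of defining maps $F_{i_1},\dots,F_{i_r}$ at $p$ with joint domain of definition, the map $(F_{i_1},\dots,F_{i_r})$ has surjective differential at $p$. The family is everywhere transversal if it is transversal at each point of $M$. In the claim, families are indexed by the pairs $(i,j)$, $j\in T^i$, and $(i,(j,k))$, $(j,k)\in R^i$. *)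

(* Defs.v *)
From HB Require Import structures.
From mathcomp Require Import all_boot all_order all_algebra.
(* The notations of mpoly clash with those of MathComp-Analysis. *)
From mathcomp Require Import -(notations) mpoly.
From mathcomp Require Import all_classical all_reals all_analysis.
Set Implicit Arguments.
Unset Strict Implicit.
Unset Printing Implicit Defensive.
Import Order.TTheory GRing.Theory Num.Theory numFieldNormedType.Exports.
Local Open Scope classical_set_scope.
Local Open Scope ring_scope.

(** * Semialgebraic sets and Lebesgue null sets in [R^K], [K] a finite type *)

Section SemialgebraicNull.
Variables (R : realType) (K : finType).

(* A finite union of sets given by finitely many equations [p = 0] and strict
   inequalities [0 < q]. *)
Definition semialgebraic (D : set (K -> R)) : Prop :=
  exists s : seq (seq (mpoly #|K| R) * seq (mpoly #|K| R)),
    D = [set x | has (fun c =>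
           all (fun p => meval (fun k => x (enum_val k)) p == 0) c.1 &&
           all (fun q => 0 < meval (fun k => x (enum_val k)) q) c.2) s].

(* Lebesgue (outer) measure 0: countable covers by boxes of arbitrarily small
   total volume. *)
Definition lebesgue_null (D : set (K -> R)) : Prop :=
  forall eps : R, 0 < eps -> exists a b : nat -> K -> R,
    [/\ forall l k, a l k <= b l k,
        D `<=` \bigcup_l [set x | forall k, a l k <= x k <= b l k] &
        (\sum_(0 <= l <oo) (\prod_k (b l k - a l k))%:E <= eps%:E)%E].

End SemialgebraicNull.

(** * Smooth maps on open subsets of [R^d] *)

Section Smooth.
Variables (R : realType) (d e : nat).

Fixpoint Ck_on (k : nat) (O : set 'rV[R]_d) (f : 'rV[R]_d -> 'rV[R]_e) : Prop :=
  if k is k'.+1 then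
    (forall x v, O x -> derivable f x v) /\ (forall v, Ck_on k' O ('D_v f))
  else forall x, O x -> {for x, continuous f}.

Definition smooth_on (O : set 'rV[R]_d) (f : 'rV[R]_d -> 'rV[R]_e) : Prop :=
  forall k, Ck_on k O f.

End Smooth.

(** * Submanifolds and transversality

   The manifold [M] of dimension [d] is given by the inverses
   [psi c : R^d -> M] of its charts, each chart having all of [R^d] as image. *)

Section Manifold.
Variables (R : realType) (d : nat) (C M : Type) (psi : C -> 'rV[R]_d -> M).

Definition open_in (O : set M) : Prop := forall c, open (psi c @^-1` O).

Definition smooth_map e (O : set M) (F : M -> 'rV[R]_e) : Prop :=
  forall c, smooth_on (psi c @^-1` O) (F \o psi c).

Definition surjective_differential e (F : M -> 'rV[R]_e) (p : M) : Prop :=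
  forall c x, psi c x = p ->
    forall y, exists v, 'd (F \o psi c) x v = y.

(* [F : O -> R^e] is a defining map for [H] at [p]; its values outside [O] are
   irrelevant. *)
Definition defining_map e (H : set M) (p : M) (O : set M) (F : M -> 'rV[R]_e) :
  Prop :=
  [/\ open_in O, O p, smooth_map O F,
      forall q, O q -> surjective_differential F q &
      H `&` O = O `&` [set q | F q = F p]].

Definition submanifold (codim : nat) (H : set M) : Prop :=
  forall p, H p ->
    exists (O : set M) (F : M -> 'rV[R]_codim), defining_map H p O F.

Definition smooth_hypersurface (H : set M) : Prop := submanifold 1 H.

(* The family consists of the [H k] with [P k].  The last clause says that the
   joint map [(F k)_k], [k] ranging over the members through [p], has surjective
   differential at [p]. *)
Definition transversal_at (K : Type) (P : set K) (H : K -> set M) (p : M) :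
  Prop :=
  (forall k, P k -> ~ H k p) \/
  exists (O : set M) (e : K -> nat) (F : forall k, M -> 'rV[R]_(e k)),
    (forall k, P k -> H k p -> defining_map (H k) p O (F k)) /\
    (forall c x, psi c x = p ->
       forall y : forall k, 'rV[R]_(e k), exists v : 'rV[R]_d,
         forall k, P k -> H k p -> 'd (F k \o psi c) x v = y k).

Definition everywhere_transversal (K : Type) (P : set K) (H : K -> set M) :
  Prop := forall p, transversal_at P H p.

End Manifold.

(** * Products of real projective spaces *)

Section Projective.
Variable R : realType.

(* The space of lines through 0 in [R^(k+1)]. *)
Definition proj (k : nat) : Type :=
  {L : {vspace 'rV[R]_k.+1} | \dim L == 1%N}.

Definition homogenize k (c : 'I_k.+1) (y : 'rV[R]_k) : 'rV[R]_k.+1 :=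
  \row_j (if unlift c j is Some j' then y 0 j' else 1).

Lemma homogenize_dim k (c : 'I_k.+1) (y : 'rV[R]_k) :
  \dim <[homogenize c y]> == 1%N.
Proof.
rewrite dim_vline eqb1; apply/eqP => /rowP/(_ c).
by rewrite !mxE unlift_none => /eqP; rewrite oner_eq0.
Qed.

(* Inverse of the affine chart [gamma_c != 0]. *)
Definition proj_param k (c : 'I_k.+1) (y : 'rV[R]_k) : proj k :=
  exist _ <[homogenize c y]>%VS (homogenize_dim c y).

Lemma proj_param_cover k (L : proj k) : exists c y, proj_param c y = L.
Proof.
case: L => L L1; set v := vpick L.
have vL : L = <[v]>%VS.
  apply/eqP; rewrite eq_sym eqEdim -memvE memv_pick (eqP L1) dim_vline vpick0.
  by rewrite -dimv_eq0 (eqP L1).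
have v0 : v != 0 by move: L1; rewrite vL dim_vline eqb1.
have /existsP[c vc] : [exists c, v 0 c != 0].
  apply: contraNT v0 => /existsPn v0; apply/eqP/rowP => c.
  by rewrite mxE; apply/eqP; rewrite -[_ == _]negbK v0.
exists c, (\row_j (v 0 (lift c j) / v 0 c)); apply: val_inj => /=.
have -> : homogenize c (\row_j (v 0 (lift c j) / v 0 c)) = (v 0 c)^-1 *: v.
  apply/rowP => j; rewrite !mxE; case: unliftP => [j' ->|->].
    by rewrite mxE mulrC.
  by rewrite mulVf.
rewrite vL; apply/eqP; rewrite eqEdim -memvE memvZ ?memv_line//=.
by rewrite !dim_vline scaler_eq0 invr_eq0 (negbTE vc) v0.
Qed.

Definition vanishes_on_line k (P : mpoly k.+1 R) (L : proj k) : Prop :=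
  forall v : 'rV[R]_k.+1, val L = <[v]>%VS -> meval (v 0) P = 0.

Definition proj_algebraic k (Z : set (proj k)) : Prop :=
  exists2 E : set (mpoly k.+1 R),
    (forall P, E P -> exists d, P \is ishomog1 d mdeg) &
    Z = [set L | forall P, E P -> vanishes_on_line P L].

Variables (m : nat) (n : 'I_m -> nat).

Definition mproj : Type := forall i : 'I_m, proj (n i).

Definition mproj_param (c : forall i, 'I_(n i).+1) (x : 'rV[R]_(\sum_i n i)) :
  mproj := fun i => proj_param (c i) (submxrow x i).

Lemma mproj_param_cover (p : mproj) : exists c x, mproj_param c x = p.
Proof.
have cy i : {cy : 'I_(n i).+1 * 'rV[R]_(n i) | proj_param cy.1 cy.2 = p i}.
  by apply: cid; have [c [y cyp]] := proj_param_cover (p i); exists (c, y).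
exists (fun i => (sval (cy i)).1), (\mxrow_i (sval (cy i)).2).
apply: functional_extensionality_dep => i.
by rewrite /mproj_param mxrowK (svalP (cy i)).
Qed.

(* The coordinate [gamma^i_j] is the variable of index [tagnat.Rank i j]. *)
Definition mvars : nat := (\sum_i (n i).+1)%N.

Definition multihomogeneous (deg : 'I_m -> nat) (P : mpoly mvars R) : Prop :=
  forall mon, mon \in msupp P ->
    forall i, (\sum_(l < mvars | tagnat.sig1 l == i) mon l = deg i)%N.

Definition mvanishes_on_lines (P : mpoly mvars R) (p : mproj) : Prop :=
  forall g : forall i, 'rV[R]_(n i).+1, (forall i, val (p i) = <[g i]>%VS) ->
    meval (fun l : 'I_mvars => g (tagnat.sig1 l) 0 (tagnat.sig2 l)) P = 0.

Definition mproj_algebraic (Z : set mproj) : Prop :=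
  exists2 E : set (mpoly mvars R),
    (forall P, E P -> exists deg, multihomogeneous deg P) &
    Z = [set p | forall P, E P -> mvanishes_on_lines P p].

Definition proj_zariski_closure k : set (proj k) -> set (proj k) :=
  smallest (@proj_algebraic k).

Definition mproj_zariski_closure : set mproj -> set mproj :=
  smallest mproj_algebraic.

End Projective.

(** * Games

   Player [i] has the pure strategies [s^i_0, ..., s^i_(n_i)], represented by
   their indices in ['I_(n i).+1]. *)

Section Game.
Variables (R : realType) (m : nat) (n : 'I_m -> nat).

Definition profile : finType := {dffun forall i : 'I_m, 'I_(n i).+1}.

(* [U (i, s)] is the utility [U^i(s)]. *)
Definition utilities : Type := 'I_m * profile -> R.

Definition mixed : Type := forall i : 'I_m, 'rV[R]_(n i).+1.

Definition in_Ai k (v : 'rV[R]_k.+1) : Prop := \sum_j v 0 j = 1.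

Definition in_A (g : mixed) : Prop := forall i, in_Ai (g i).

Definition VW (U : utilities) (i : 'I_m) (g : mixed) : R :=
  \sum_(s : profile) (\prod_(k < m) g k 0 (s k)) * U (i, s).

(* The tuple [g] with its [i]-th entry replaced by the vertex [s^i_j]. *)
Definition set_pure (g : mixed) (i : 'I_m) (j : 'I_(n i).+1) : mixed :=
  @eqtype.dfwith _ _ g i (delta_mx 0 j).

(* The coefficients of the affine function [gamma^i |-> V^i_A]; the lemmas
   [VA_decomposition], [kappa_lambda_indep] and [VA_decomposition_unique] below
   characterize them. *)
Definition kappa (U : utilities) (i : 'I_m) (g : mixed) : R :=
  VW U i (set_pure g (ord0 : 'I_(n i).+1)).

Definition lambda (U : utilities) (i : 'I_m) (j : 'I_(n i).+1) (g : mixed) : R :=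
  VW U i (set_pure g j) - VW U i (set_pure g (ord0 : 'I_(n i).+1)).

Definition indep_of_factor (i : 'I_m) (f : mixed -> R) : Prop :=
  forall g h : mixed, in_A g -> in_A h ->
    (forall l, l != i -> g l = h l) -> f g = f h.

Lemma set_pure_eq (g h : mixed) (i : 'I_m) (j : 'I_(n i).+1) :
  (forall l, l != i -> g l = h l) -> set_pure g j = set_pure h j.
Proof.
move=> gh; apply: functional_extensionality_dep => l; rewrite /set_pure.
have [->|li] := eqVneq l i; first by rewrite !eqtype.dfwith_in.
by rewrite !eqtype.dfwith_out 1?eq_sym// gh.
Qed.

Lemma set_pure_in_A (g : mixed) (i : 'I_m) (j : 'I_(n i).+1) :
  in_A g -> in_A (set_pure g j).
Proof.
move=> gA l; rewrite /set_pure; have [->|li] := eqVneq l i.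
  rewrite eqtype.dfwith_in /in_Ai (bigD1 j)//= mxE !eqxx big1 ?addr0// => j' /negbTE.
  by rewrite mxE => ->; rewrite andbF.
by rewrite eqtype.dfwith_out 1?eq_sym.
Qed.

Lemma kappa_lambda_indep (U : utilities) (i : 'I_m) :
  indep_of_factor i (kappa U i) /\
  forall j, indep_of_factor i (lambda U (i := i) j).
Proof.
by split=> [|j] g h _ _ gh; rewrite /kappa /lambda !(set_pure_eq _ gh).
Qed.

Lemma lambda0 (U : utilities) (i : 'I_m) (g : mixed) :
  lambda U (ord0 : 'I_(n i).+1) g = 0.
Proof. by rewrite /lambda subrr. Qed.

Lemma VW_linear (U : utilities) (i : 'I_m) (g : mixed) :
  VW U i g = \sum_j g i 0 j * VW U i (set_pure g j).
Proof.
under [RHS]eq_bigr do rewrite mulr_sumr.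
rewrite exchange_big/=; apply: eq_bigr => s _.
rewrite [RHS](bigD1 (s i))//= [X in _ = _ + X]big1 ?addr0.
  rewrite mulrA; congr (_ * _); rewrite [LHS](bigD1 i)//=; congr (_ * _).
  rewrite [RHS](bigD1 i)//= /set_pure eqtype.dfwith_in mxE !eqxx mul1r.
  by apply: eq_bigr => l li; rewrite eqtype.dfwith_out 1?eq_sym.
move=> j jsi; rewrite (bigD1 i)//= /set_pure eqtype.dfwith_in mxE/=.
by rewrite eq_sym (negbTE jsi) !mul0r mulr0.
Qed.

Lemma VA_decomposition (U : utilities) (i : 'I_m) (g : mixed) : in_A g ->
  VW U i g =
    kappa U i g + \sum_(j | j != ord0) g i 0 j * lambda U j g.
Proof.
move=> gA; have := gA i; rewrite /in_Ai (bigD1 ord0)//= => g1.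
rewrite VW_linear (bigD1 ord0)//= -(addrK (\sum_(j | j != ord0) g i 0 j) (g i 0 ord0)).
rewrite g1 mulrBl mul1r -addrA; congr (_ + _).
rewrite addrC mulr_suml -sumrB.
by apply: eq_bigr => j _; rewrite /lambda mulrBr.
Qed.

Lemma VA_decomposition_unique (U : utilities) (i : 'I_m)
    (kap : mixed -> R) (lam : 'I_(n i).+1 -> mixed -> R) :
  indep_of_factor i kap -> (forall j, indep_of_factor i (lam j)) ->
  (forall g, in_A g ->
     VW U i g = kap g + \sum_(j | j != ord0) g i 0 j * lam j g) ->
  forall g, in_A g ->
    kap g = kappa U i g /\
    forall j, j != ord0 -> lam j g = lambda U j g.
Proof.
move=> kapI lamI dec g gA.
have off j l : l != i -> set_pure g (i := i) j l = g l.
  by move=> li; rewrite /set_pure eqtype.dfwith_out 1?eq_sym.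
have V0 : VW U i (set_pure g (ord0 : 'I_(n i).+1)) = kap g.
  rewrite dec; last exact: set_pure_in_A.
  rewrite big1 ?addr0; first by apply: kapI => //; [exact: set_pure_in_A|exact: off].
  by move=> j /negbTE j0; rewrite /set_pure eqtype.dfwith_in mxE j0 andbF mul0r.
split=> [//|j j0].
rewrite /lambda V0 dec; last exact: set_pure_in_A.
rewrite (bigD1 j)//= big1 ?addr0.
  rewrite {2}/set_pure eqtype.dfwith_in mxE !eqxx mul1r.
  rewrite (kapI _ g) ?(lamI j _ g) 1?addrAC ?subrr ?add0r//;
    by [exact: set_pure_in_A|exact: off].
by move=> l /andP[_ /negbTE lj]; rewrite /set_pure eqtype.dfwith_in mxE lj andbF mul0r.
Qed.

(** ** The hypersurfaces in the product of the projective spaces *)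

Definition H_inf (i : 'I_m) : set (mproj R n) :=
  [set p | ~ exists2 v, in_Ai v & val (p i) = <[v]>%VS].

Definition H_coord (i : 'I_m) (j : 'I_(n i).+1) : set (mproj R n) :=
  [set p | proj_zariski_closure
             [set L | exists v, [/\ in_Ai v, v 0 j = 0 & val L = <[v]>%VS]]
             (p i)].

Definition H_diff (U : utilities) (i : 'I_m) (j k : 'I_(n i).+1) :
  set (mproj R n) :=
  mproj_zariski_closure
    [set p | exists g : mixed,
       [/\ in_A g, lambda U j g - lambda U k g = 0 &
           forall l, val (p l) = <[g l]>%VS]].

(* [None] stands for the index oo. *)
Definition H_hyp (i : 'I_m) (j : option 'I_(n i).+1) : set (mproj R n) :=
  if j is Some j' then H_coord j' else H_inf i.

(* The indices [(i, j)] and [(i, (j, k))] of a family. *)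
Definition family_index : Type :=
  {i : 'I_m & (option 'I_(n i).+1 + 'I_(n i).+1 * 'I_(n i).+1)%type}.

Definition hypersurface_family (U : utilities) (x : family_index) : set (mproj R n) :=
  match tagged x with
  | inl j => H_hyp j
  | inr jk => H_diff U jk.1 jk.2
  end.

Definition family_members (T : forall i, {set option 'I_(n i).+1})
    (E : forall i, {set 'I_(n i).+1 * 'I_(n i).+1}) : set family_index :=
  [set x | match tagged x with
           | inl j => j \in T (tag x)
           | inr jk => jk \in E (tag x)
           end].

End Game.

Definition edge_rel (V : finType) (E : {set V * V}) : rel V :=
  fun j k => ((j, k) \in E) || ((k, j) \in E).

(* The graph with edge set [E] has no cycles; [E] is meant to be such that
   [edge_rel E] is irreflexive. *)
Definition union_of_trees (V : finType) (E : {set V * V}) : Prop :=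
  forall c : seq V, (2 < size c)%N -> ~ ucycle (edge_rel E) c.

(* Main.v *)
(* For a player [i] and two of its strategies [j], [k], the difference
   [lambda^i_j - lambda^i_k] homogenizes to a form [Lam] that is linear in each factor
   [g l], [l <> i], and in the utilities.  Transversality at a point means that the
   differentials of the equations vanishing there are linearly independent.  The
   coordinate hyperplanes and the hyperplane at infinity are in general position, so
   only the restrictions of the forms [Lam] to the intersections [K l] of some of these
   hyperplanes matter: they must not satisfy [Lam_r (g) = 0] for all [r] in a set [Rs]
   and [sum_r b_r dLam_r (g) = 0] on all [K l], with [b_r <> 0].  For fixed [(g, b)]
   these are linear equations on the utilities.  As [Rs] is a forest, the tensors [Lam_r]
   can be prescribed independently, which makes the equations linearly independent, and
   their number exceeds by one that of the parameters [(g, b)].  Solving them by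
   Cramer's rule, one parametrizes the bad utilities by rational maps in fewer variables
   than the dimension of the space of utilities; the coordinates of such a map are
   algebraically dependent, so the bad utilities lie in the zero set of a nonzero
   polynomial, which is semialgebraic and null. *)

Require Import Defs.
From mathcomp Require Import all_boot all_order all_algebra.
From mathcomp Require Import -(notations) mpoly.
From mathcomp Require Import all_classical all_reals all_analysis.
From mathcomp Require Import ring lra zify.
Set Implicit Arguments.
Unset Strict Implicit.
Unset Printing Implicit Defensive.
Import Order.TTheory GRing.Theory Num.Theory numFieldNormedType.Exports.
Local Open Scope classical_set_scope.
Local Open Scope ring_scope.

(** * Polynomial functions and thin sets *)

Section PolynomialFunctions.
Variable R : realType.

(** The surplus of one equation arises as follows. In each factor one coordinate of [g l] is
    normalized, and one direction is dropped from the relation between differentials, since by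
    homogeneity the derivative along [g l] itself already vanishes; these parameters and equations
    balance. The equations [Lam_r (g) = 0] then outnumber by one the coefficients [b_r], one of
    which is normalized to 1. The corrections that prescribe the relation divide by [b_r], so a
    relation is always cut down to its support, which is again a forest. A factor on which none of
    the forms depends would spoil the balance and is left out of the count. A separate obstacle is
    that the difference hypersurfaces are defined as Zariski closures, whose points at infinity are
    not given by equations. That the zero set of the homogenized form has no additional component at
    infinity is itself a consequence of genericity, applied to this form together with the
    hyperplanes at infinity. *)

Definition peval (X : finType) (P : mpoly #|X| R) (t : X -> R) : R :=
  meval (fun k => t (enum_val k)) P.

(** A predicate on functions, so that determinants, adjugates and multilinear forms are treated by
    closure rules and the polynomials are never written out. *)
Definition polyfun (X : finType) (f : (X -> R) -> R) : Prop :=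
  exists P : mpoly #|X| R, forall t, f t = peval P t.

Section Closure.
Variable X : finType.
Implicit Types f g : (X -> R) -> R.

Lemma polyfun_ext f g : (forall t, f t = g t) -> polyfun f -> polyfun g.
Proof. by move=> fg [P fP]; exists P => t; rewrite -fg. Qed.

Lemma polyfun_const (a : R) : @polyfun X (fun=> a).
Proof. by exists (mpolyC #|X| a) => t; rewrite /peval mevalC. Qed.

Lemma polyfun_var (x : X) : @polyfun X (fun t => t x).
Proof.
exists (mpolyX R (mnm1 (enum_rank x))) => t.
by rewrite /peval mevalXU enum_rankK.
Qed.

Lemma polyfunD f g : polyfun f -> polyfun g -> polyfun (fun t => f t + g t).
Proof. by move=> [P fP] [Q gQ]; exists (P + Q) => t; rewrite /peval mevalD fP gQ. Qed.

Lemma polyfunM f g : polyfun f -> polyfun g -> polyfun (fun t => f t * g t).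
Proof. by move=> [P fP] [Q gQ]; exists (P * Q) => t; rewrite /peval mevalM fP gQ. Qed.

Lemma polyfunN f : polyfun f -> polyfun (fun t => - f t).
Proof. by move=> [P fP]; exists (- P) => t; rewrite /peval mevalN fP. Qed.

Lemma polyfun_sum (I : Type) (r : seq I) (P : pred I) (F : I -> (X -> R) -> R) :
  (forall i, P i -> polyfun (F i)) -> polyfun (fun t => \sum_(i <- r | P i) F i t).
Proof.
move=> FP; elim: r => [|i r IH].
  by apply: polyfun_ext (polyfun_const 0) => t; rewrite big_nil.
case Pi: (P i); last by apply: polyfun_ext IH => t; rewrite big_cons Pi.
by apply: polyfun_ext (polyfunD (FP i Pi) IH) => t; rewrite big_cons Pi.
Qed.

Lemma polyfun_prod (I : Type) (r : seq I) (P : pred I) (F : I -> (X -> R) -> R) :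
  (forall i, P i -> polyfun (F i)) -> polyfun (fun t => \prod_(i <- r | P i) F i t).
Proof.
move=> FP; elim: r => [|i r IH].
  by apply: polyfun_ext (polyfun_const 1) => t; rewrite big_nil.
case Pi: (P i); last by apply: polyfun_ext IH => t; rewrite big_cons Pi.
by apply: polyfun_ext (polyfunM (FP i Pi) IH) => t; rewrite big_cons Pi.
Qed.

Lemma polyfun_det (n : nat) (A : (X -> R) -> 'M[R]_n) :
  (forall i j, polyfun (fun t => A t i j)) -> polyfun (fun t => \det (A t)).
Proof.
move=> AP; apply: polyfun_sum => s _; apply: polyfunM; first exact: polyfun_const.
by apply: polyfun_prod => i _; exact: AP.
Qed.

Lemma polyfun_adj (n : nat) (A : (X -> R) -> 'M[R]_n) :
  (forall i j, polyfun (fun t => A t i j)) ->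
  forall i j, polyfun (fun t => (\adj (A t)) i j).
Proof.
move=> AP i j.
apply: (@polyfun_ext (fun t => cofactor (A t) j i)) => [t|]; first by rewrite mxE.
apply: polyfunM; first exact: polyfun_const.
apply: polyfun_det => a b.
by apply: polyfun_ext (AP (lift j a) (lift i b)) => t; rewrite !mxE.
Qed.

End Closure.

(** * Algebraic dependence of rational functions in few variables *)

Lemma card_bmultinom (q k : nat) : (#|{: bmultinom q k}| <= k ^ q)%N.
Proof.
have ltk (b : bmultinom q k) (i : 'I_q) : (bmnm b i < k)%N.
  apply: leq_ltn_trans (bmdeg b); rewrite mdegE (bigD1 i) //=; exact: leq_addr.
have -> : (k ^ q = #|{ffun 'I_q -> 'I_k}|)%N by rewrite card_ffun !card_ord.
apply: (@leq_card _ _ (fun b : bmultinom q k => [ffun i => Ordinal (ltk b i)])).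
move=> b b' /ffunP bb'; apply/val_inj/mnmP => i.
by have := bb' i; rewrite !ffunE => /(congr1 val).
Qed.

Lemma msizeM_bound (q a b : nat) (P Q : mpoly q R) :
  (msize P <= a.+1)%N -> (msize Q <= b.+1)%N -> (msize (P * Q) <= (a + b).+1)%N.
Proof.
move=> Pa Qb; have [->|P0] := eqVneq P 0; first by rewrite mul0r msize0.
have [->|Q0] := eqVneq Q 0; first by rewrite mulr0 msize0.
rewrite msizeM //; apply: (@leq_trans (a.+1 + b.+1).-1); last by rewrite addSn addnS.
by rewrite -!subn1 leq_sub2r // leq_add.
Qed.

Lemma msizeX_bound (q a k : nat) (P : mpoly q R) :
  (msize P <= a.+1)%N -> (msize (P ^+ k) <= (k * a).+1)%N.
Proof.
move=> Pa; elim: k => [|k IH]; first by rewrite expr0 msize1.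
by rewrite exprS mulSn; exact: msizeM_bound.
Qed.

Lemma msize_prod_bound (q a : nat) (I : finType) (F : I -> mpoly q R) :
  (forall i, msize (F i) <= a.+1)%N -> (msize (\prod_i F i) <= (#|I| * a).+1)%N.
Proof.
move=> Fa; rewrite cardE -[X in msize X]/(\prod_(i <- index_enum I) F i).
rewrite -big_enum /=; elim: (enum I) => [|i r IH]; first by rewrite big_nil msize1.
by rewrite big_cons /= mulSn; exact: msizeM_bound.
Qed.

(* The monomials of degree [< d] in each of the [#|N|] variables number
   [d ^ #|N|]; after multiplication by the common denominator they land in a space
   of dimension [O(d ^ #|X|)]. *)
Lemma algebraic_dependence (X N : finType) (p : N -> (X -> R) -> R)
    (delta : (X -> R) -> R) :
  (#|X| < #|N|)%N -> (forall n, polyfun (p n)) -> polyfun delta ->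
  exists2 Q : mpoly #|N| R, Q != 0 &
    forall t, delta t != 0 -> peval Q (fun n => p n t / delta t) = 0.
Proof.
move=> XN /choice[P pP] [D dD].
set e := maxn (msize D) (\max_n msize (P n)).
have De : (msize D <= e.+1)%N by apply: leqW; exact: leq_maxl.
have Pe n : (msize (P n) <= e.+1)%N.
  apply: leqW; apply: leq_trans (leq_maxr _ _).
  exact: (@leq_bigmax _ (fun n => msize (P n))).
(* The choice gives [k <= d * c] and [c ^ #|X| < d], hence [k ^ #|X| <= d ^ #|X| * c ^ #|X| < d ^
   #|X|.+1 <= d ^ #|N|]: there are more monomials than dimensions. *)
set c := (#|N| * e).+1; set d := (c ^ #|X|).+1; set k := (#|N| * (d * e)).+1.
pose I : finType := {ffun N -> 'I_d}; pose J : finType := bmultinom #|X| k.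
have JI : (#|J| < #|I|)%N.
  rewrite card_ffun card_ord; apply: leq_ltn_trans (card_bmultinom _ _) _.
  have kc : (k <= d * c)%N by rewrite /k /c; nia.
  have kq : (k ^ #|X| <= (d * c) ^ #|X|)%N.
    by case: #|X| => [//|x]; rewrite leq_exp2r.
  apply: leq_ltn_trans kq _; rewrite expnMn.
  apply: leq_trans (_ : d ^ #|X| * d <= _)%N; first by rewrite ltn_pmul2l ?expn_gt0.
  by rewrite -expnSr leq_pexp2l.
(* The monomial with exponents [a] in the quotients [p n / delta], multiplied by the common
   denominator [delta ^ (d * #|N|)]. *)
pose T (a : I) := \prod_n (P n ^+ a n * D ^+ (d - a n)).
have Tk a : (msize (T a) <= k)%N.
  apply: msize_prod_bound => n.
  apply: leq_trans (msizeM_bound (msizeX_bound _ (Pe n)) (msizeX_bound _ De)) _.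
  by rewrite ltnS -mulnDl subnKC // ltnW.
pose M : 'M[R]_(#|I|, #|J|) :=
  \matrix_(i, j) mcoeff (bmnm (enum_val j)) (T (enum_val i)).
have /rowV0Pn[v /sub_kermxP vM v0] : kermx M != 0.
  rewrite -mxrank_eq0 mxrank_ker subn_eq0 -ltnNge.
  by apply: leq_ltn_trans JI; exact: rank_leq_col.
pose mon (a : I) : multinom #|N| := Multinom [tuple (a (enum_val i) : nat) | i < #|N|].
have mon_inj : injective mon.
  move=> a b /mnmP ab; apply/ffunP => n; apply: val_inj => /=.
  by have := ab (enum_rank n); rewrite !mnmE enum_rankK.
exists (\sum_i v 0 i *: mpolyX R (mon (enum_val i))).
  have /eqP/rowP/eqfunP/forallPn[i vi] := v0.
  apply: contraNneq vi => /(congr1 (mcoeff (mon (enum_val i)))).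
  rewrite raddf_sum mcoeff0 (bigD1 i) //= mcoeffZ mcoeffX eqxx mulr1 big1 ?addr0.
    by move=> ->; rewrite mxE.
  move=> j /negbTE ji; rewrite mcoeffZ mcoeffX (inj_eq mon_inj) (inj_eq enum_val_inj) ji.
  by rewrite mulr0.
move=> t dt0; rewrite /peval raddf_sum /=.
apply: (@mulfI _ (delta t ^+ d ^+ #|N|)); first by rewrite !expf_neq0.
rewrite mulr0 mulr_sumr.
transitivity (\sum_i v 0 i * meval (fun k => t (enum_val k)) (T (enum_val i))).
  apply: eq_bigr => i _; rewrite mevalZ mulrCA; congr (_ * _).
  rewrite mevalX /T rmorph_prod /=.
  rewrite (reindex_onto enum_rank enum_val) /=; last by move=> ? _; rewrite enum_valK.
  rewrite (eq_bigl predT) => [|n]; last by rewrite enum_rankK eqxx.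
  rewrite -prodr_const -big_split /=; apply: eq_bigr => n _.
  rewrite mnmE enum_rankK mevalM !rmorphXn /= -/(peval _ _) -pP -/(peval _ _) -dD.
  have pow (x y : R) (a b : nat) : y != 0 -> (a <= b)%N ->
      y ^+ b * (x / y) ^+ a = x ^+ a * y ^+ (b - a).
    move=> y0 ae; rewrite -[in LHS](subnK ae) exprD exprMn exprVn.
    by rewrite mulrCA -!mulrA divff ?expf_neq0 // mulr1.
  by apply: pow; rewrite // ltnW.
under eq_bigr do rewrite (mpolywE (Tk _)) raddf_sum mulr_sumr /=.
rewrite exchange_big big1 //= => b _.
under eq_bigr do rewrite mevalZ mulrA.
rewrite -mulr_suml; have /rowP/(_ (enum_rank b)) := vM; rewrite !mxE => vb0.
rewrite [X in X * _](_ : _ = 0) ?mul0r // -[RHS]vb0.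
by apply: eq_bigr => i _; rewrite mxE enum_rankK.
Qed.

Lemma polyfun_meval (X : finType) (N : nat) (P : mpoly N R) (q : 'I_N -> (X -> R) -> R) :
  (forall a, polyfun (q a)) -> polyfun (fun t => meval (fun a => q a t) P).
Proof.
move=> qP.
apply: (@polyfun_ext X (fun t => \sum_(m <- msupp P)
    mcoeff m P * \prod_i \prod_(j < m i) q i t)) => [t|].
  rewrite mevalE; apply: eq_bigr => m _; congr (_ * _).
  by apply: eq_bigr => i _; rewrite prodr_const card_ord.
apply: polyfun_sum => m _; apply: polyfunM; first exact: polyfun_const.
by apply: polyfun_prod => i _; apply: polyfun_prod.
Qed.

Lemma polyfun_comp (X Z : finType) (f : (X -> R) -> R) (g : X -> (Z -> R) -> R) :
  polyfun f -> (forall x, polyfun (g x)) -> polyfun (fun z => f (fun x => g x z)).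
Proof.
move=> [P fP] gP; apply: (polyfun_ext (fun z => esym (fP _))).
exact: (@polyfun_meval Z _ P (fun a => g (enum_val a))).
Qed.

(** * Thin sets and solutions of overdetermined linear systems *)

(** A single notion of smallness that is stable under finite unions and yields both a semialgebraic
    and a null superset. *)
Definition thin (K : finType) (B : set (K -> R)) : Prop :=
  exists2 Q : mpoly #|K| R, Q != 0 & forall U, B U -> peval Q U = 0.

Lemma thin_sub (K : finType) (B B' : set (K -> R)) :
  B `<=` B' -> thin B' -> thin B.
Proof. by move=> BB' [Q Q0 B'Q]; exists Q => // U /BB'/B'Q. Qed.

Lemma thin0 (K : finType) : thin (@set0 (K -> R)).
Proof. by exists 1; rewrite ?oner_neq0. Qed.

Lemma thin_bigcup (K I : finType) (F : I -> set (K -> R)) :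
  (forall i, thin (F i)) -> thin (\bigcup_i F i).
Proof.
move=> Fthin; have {Fthin}/choice[Q QP] : forall i, exists Q : mpoly #|K| R,
    Q != 0 /\ forall U, F i U -> peval Q U = 0.
  by move=> i; have [Q Q0 FQ] := Fthin i; exists Q.
exists (\prod_i Q i); first by apply/prodf_neq0 => i _; case: (QP i).
move=> U [i _ FiU]; rewrite /peval rmorph_prod (bigD1 i) //=.
by rewrite -/(peval _ _) (QP i).2 // mul0r.
Qed.

Lemma linear_coordE (K : finType) (L : (K -> R) -> R) :
  (forall a U V, L (fun k => a * U k + V k) = a * L U + L V) ->
  forall U, L U = \sum_k L (fun k' => (k' == k)%:R) * U k.
Proof.
move=> Llin U.
have L0 : L (fun=> 0) = 0.
  have := Llin 1 (fun=> 0) (fun=> 0).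
  rewrite (_ : (fun=> _) = fun=> 0); last by apply/funext => k; rewrite mulr0 addr0.
  by rewrite mul1r => /eqP; rewrite addrC -subr_eq subrr eq_sym => /eqP.
have H (r : seq K) : L (fun k => \sum_(k' <- r) U k' * (k == k')%:R) =
    \sum_(k <- r) L (fun k' => (k' == k)%:R) * U k.
  elim: r => [|k r IH].
    by rewrite big_nil -[RHS]L0; congr L; apply/funext => k; rewrite big_nil.
  rewrite big_cons -IH mulrC -Llin; congr L; apply/funext => k'.
  by rewrite big_cons.
rewrite -H; congr L; apply/funext => k.
rewrite (bigD1 k) //= eqxx mulr1 big1 ?addr0 // => i /negbTE ik.
by rewrite eq_sym ik mulr0.
Qed.

(* On the locus where the minor with columns [f] does not vanish, Cramer's rule
   expresses [U] rationally in terms of [t] and the entries of [U] outside [f]. *)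
Lemma thin_minor (X K : finType) (e : nat) (A : (X -> R) -> 'M[R]_(e, #|K|))
    (f : 'I_e -> 'I_#|K|) :
  (#|X| < e)%N -> (forall i j, polyfun (fun t => A t i j)) ->
  (* If [f] is not injective, the minor has two equal columns and the set is empty. *)
  thin [set U : K -> R | exists2 t, A t *m (\col_k U (enum_val k)) = 0 &
                         \det (colsub f (A t)) != 0].
Proof.
move=> Xe AP; have [f_inj|f_ninj] := boolP (injectiveb f); last first.
  apply: thin_sub (@thin0 K) => U [t _ /eqP[]].
  move/injectivePn: f_ninj => [i [j ij fij]].
  by rewrite -det_tr; apply: (determinant_alternate ij) => k; rewrite !mxE fij.
move/injectiveP in f_inj.
pose S := {k : 'I_#|K| | k \notin codom f}; pose Z : finType := (X + S)%type.
have ZK : (#|Z| < #|K|)%N.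
  have := cardC (mem (codom f)); rewrite card_codom // !card_ord.
  rewrite card_sum card_sig => cardK.
  by apply: leq_trans (_ : _ <= e + #|predC (mem (codom f))|)%N _; rewrite ?ltn_add2r ?cardK.
pose tz (z : Z -> R) : X -> R := fun x => z (inl x).
pose rest (z : Z -> R) : 'cV[R]_#|K| :=
  \col_k (if insub k is Some s then z (inr (s : S)) else 0).
pose B t := colsub f (A t); pose delta z := \det (B (tz z)).
(* [E] inserts a vector of length [e] at the positions [f]; thus [p z / delta z] is the solution of
   the system whose entries outside [f] are those of [rest z]. *)
pose E : 'M[R]_(#|K|, e) := \matrix_(k, i) (k == f i)%:R.
pose p z : 'cV[R]_#|K| :=
  delta z *: rest z - E *m (\adj (B (tz z)) *m (A (tz z) *m rest z)).
have AzP i j : polyfun (fun z : Z -> R => A (tz z) i j).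
  by apply: (polyfun_comp (AP i j)) => x; exact: polyfun_var.
have BP i j : polyfun (fun z : Z -> R => B (tz z) i j).
  by apply: (polyfun_ext _ (AzP i (f j))) => z; rewrite !mxE.
have deltaP : polyfun delta by exact: polyfun_det.
have restP k : polyfun (fun z : Z -> R => rest z k 0).
  case E1: (insub k : option S) => [s|].
    by apply: polyfun_ext (polyfun_var (inr s)) => z; rewrite mxE E1.
  by apply: (polyfun_ext _ (polyfun_const Z 0)) => z; rewrite mxE E1.
have pP k : polyfun (fun z => p z k 0).
  apply: (@polyfun_ext Z (fun z => delta z * rest z k 0 - \sum_i E k i *
     \sum_j (\adj (B (tz z))) i j * \sum_l A (tz z) j l * rest z l 0)) => [z|].
    rewrite [RHS]mxE [X in _ = X + _]mxE [X in _ = _ + X]mxE [X in _ = _ - X]mxE.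
    congr (_ - _); apply: eq_bigr => i _; congr (_ * _); rewrite mxE.
    by apply: eq_bigr => j _; congr (_ * _); rewrite mxE.
  apply: polyfunD; first exact: polyfunM.
  apply/polyfunN/polyfun_sum => i _; apply: polyfunM; first exact: polyfun_const.
  apply: polyfun_sum => j _; apply: polyfunM; first exact: polyfun_adj.
  by apply: polyfun_sum => l _; apply: polyfunM.
have [Q Q0 QP] := algebraic_dependence (p := fun k z => p z (enum_rank k) 0) ZK
  (fun k => pP (enum_rank k)) deltaP.
exists Q => // U [t AU0 dt0].
pose z : Z -> R := fun x => match x with inl x => t x | inr s => U (enum_val (val s)) end.
have tzE : tz z = t by [].
have dz : delta z != 0 by rewrite /delta tzE.
rewrite -(QP z dz); congr peval; apply/funext => k.
suff -> : p z = delta z *: (\col_k U (enum_val k)).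
  by rewrite !mxE enum_rankK mulrC mulKf.
set u := \col_k U (enum_val k) in AU0 *.
have uE : u = rest z + E *m (\col_i u (f i) 0).
  apply/colP => {}k; rewrite !mxE; case: insubP => [s sk vs|] /=.
    rewrite big1 ?addr0 ?vs // => i _; rewrite [E k i]mxE.
    by have [ki|] := eqVneq k (f i); rewrite ?mul0r //; move: sk; rewrite ki codom_f.
  rewrite negbK => /codomP[i ->]; rewrite add0r (bigD1 i) //= big1 => [|j ji].
    by rewrite !mxE eqxx mul1r addr0.
  by rewrite !mxE (inj_eq f_inj) eq_sym (negbTE ji) mul0r.
have AE : A t *m E = B t.
  apply/matrixP => i j; rewrite !mxE (bigD1 (f j)) //= mxE eqxx mulr1 big1 ?addr0 //.
  by move=> l /negbTE lf; rewrite mxE lf mulr0.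
have Arest : A (tz z) *m rest z = - (B t *m (\col_i u (f i) 0)).
  by apply/eqP; rewrite -addr_eq0 tzE -AE -mulmxA -mulmxDr -uE AU0.
rewrite /p Arest tzE mulmxN mulmxN opprK [\adj _ *m _]mulmxA mul_adj_mx mul_scalar_mx -scalemxAr.
by rewrite -scalerDr -uE.
Qed.

(** A surjective system has an invertible maximal minor. There are finitely many choices of its
    columns, and each contributes a set that is thin by Cramer's rule. *)
Lemma thin_incidence (X Y K : finType) (L : Y -> (X -> R) -> (K -> R) -> R) :
  (#|X| < #|Y|)%N ->
  (forall y t a U V, L y t (fun k => a * U k + V k) = a * L y t U + L y t V) ->
  (forall y U, polyfun (fun t => L y t U)) ->
  thin [set U | exists t, (forall y, L y t U = 0) /\
                 (forall z : Y -> R, exists V, forall y, L y t V = z y)].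
Proof.
move=> XY Llin LP.
pose A t : 'M[R]_(#|Y|, #|K|) :=
  \matrix_(y, k) L (enum_val y) t (fun k' => (k' == enum_val k)%:R).
have LE t U : A t *m (\col_k U (enum_val k)) = \col_y L (enum_val y) t U.
  apply/colP => y; rewrite !mxE (linear_coordE (Llin _ t)).
  by rewrite [RHS](big_enum_val); apply: eq_bigr => k _; rewrite !mxE.
apply: thin_sub (thin_bigcup (I := {ffun 'I_#|Y| -> 'I_#|K|}) (F := fun f =>
  [set U : K -> R | exists2 t, A t *m (\col_k U (enum_val k)) = 0 &
                         \det (colsub f (A t)) != 0]) _); last first.
  by move=> f; apply: thin_minor => // i j; apply: polyfun_ext (LP _ _) => t; rewrite mxE.
move=> U [t [LU0 Lsurj]].
have Afull : row_full (A t)^T.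
  have /choice[V VE] : forall i : 'I_#|Y|, exists V,
      forall y, L y t V = (y == enum_val i)%:R.
    by move=> i; exact: Lsurj.
  apply/row_fullP; exists (\matrix_(i, k) V i (enum_val k)).
  apply/matrixP => i j; have /colP/(_ j) := LE t (V i); rewrite !mxE VE.
  rewrite (inj_eq enum_val_inj) eq_sym => <-.
  by apply: eq_bigr => k _; rewrite !mxE mulrC.
exists (fullrankfun Afull) => //; exists t.
  by rewrite LE; apply/colP => y; rewrite !mxE LU0.
rewrite -unitfE -unitmxE -unitmx_tr trmx_mxsub -row_full_unit.
exact: fullrowsub_full.
Qed.

End PolynomialFunctions.

(** * Zero sets of polynomials are Lebesgue null *)

Section NullSets.
Variables (R : realType) (K : finType).
Implicit Types (D : set (K -> R)) (a b x : K -> R).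

Definition box a b : set (K -> R) := [set x | forall k, a k <= x k <= b k].
Definition volume a b : R := \prod_k (b k - a k).

Lemma volume_ge0 a b : (forall k, a k <= b k) -> 0 <= volume a b.
Proof. by move=> ab; apply: prodr_ge0 => k _; rewrite subr_ge0. Qed.

Lemma lebesgue_null_cover (k0 : K) D :
  (forall eps : R, 0 < eps -> exists (I : countType) (a b : I -> K -> R),
    [/\ forall i k, a i k <= b i k, D `<=` \bigcup_i box (a i) (b i) &
        (\esum_(i in [set: I]) (volume (a i) (b i))%:E <= eps%:E)%E]) ->
  lebesgue_null D.
Proof.
move=> H eps /H[I [a [b [ab Dab vol]]]].
pose c (f : I -> K -> R) (l : nat) : K -> R :=
  if pickle_inv l is Some i then f i else fun=> 0.
have cab l k : c a l k <= c b l k by rewrite /c; case: pickle_inv.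
have cE f i : c f (pickle i) = f i by rewrite /c pickleK_inv.
exists (c a), (c b); split => //.
  move=> x /Dab[i _ xi]; exists (pickle i) => // k; rewrite !cE; exact: xi.
rewrite -[X in (X <= _)%E]/(\sum_(l <oo) (volume (c a l) (c b l))%:E)%E.
rewrite nneseries_esumT => [|l]; last by rewrite lee_fin volume_ge0.
have -> : (\esum_(l in [set: nat]) (volume (c a l) (c b l))%:E =
          \esum_(l in pickle @` [set: I]) (volume (c a l) (c b l))%:E)%E.
  rewrite [RHS]esum_mkcond; apply: eq_esum => l _; case: ifPn => //.
  rewrite notin_setE => lI; rewrite /c; case E : (pickle_inv l) => [i|].
    case: lI; exists i => //; have := @pickle_invK I l.
    by rewrite /oapp E.
  by rewrite /volume (bigD1 k0) //= subrr mul0r.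
rewrite esum_image; last by move=> i j _ _; exact: (pcan_inj pickleK_inv).
by under eq_esum do rewrite !cE.
Qed.

Lemma lebesgue_null_sub D D' : D `<=` D' -> lebesgue_null D' -> lebesgue_null D.
Proof.
move=> DD' D'0 eps /D'0[a [b [ab D'ab vol]]]; exists a, b; split => //.
exact: subset_trans D'ab.
Qed.

Lemma lebesgue_null_bigcup (k0 : K) (J : countType) (F : J -> set (K -> R)) :
  (forall j, lebesgue_null (F j)) -> lebesgue_null (\bigcup_j F j).
Proof.
move=> F0; apply: (lebesgue_null_cover k0) => eps eps0.
pose e (j : J) : R := eps / (2 ^ (pickle j).+1)%:R.
have e0 j : 0 < e j by rewrite divr_gt0 // ltr0n expn_gt0.
have /choice[ab abP'] (j : J) : exists ab : (nat -> K -> R) * (nat -> K -> R),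
    [/\ forall l k, ab.1 l k <= ab.2 l k, F j `<=` \bigcup_l box (ab.1 l) (ab.2 l) &
        (\sum_(0 <= l <oo) (volume (ab.1 l) (ab.2 l))%:E <= (e j)%:E)%E].
  by have [a [b ?]] := F0 j (e j) (e0 j); exists (a, b).
pose a j := (ab j).1; pose b j := (ab j).2; have abP := abP'.
exists (J * nat)%type, (fun i => a i.1 i.2), (fun i => b i.1 i.2); split.
- by move=> [j l] k /=; have [le_ab _ _] := abP j; exact: le_ab.
- move=> x [j _ Fx]; have [_ /(_ x Fx)[l _ xl] _] := abP j.
  by exists (j, l).
have vol0 j l : 0 <= volume (a j l) (b j l).
  by apply: volume_ge0 => k; have [le_ab _ _] := abP j; exact: le_ab.
rewrite (_ : setT = [set: J] `*`` (fun=> [set: nat])); last by apply/seteqP.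
rewrite -(@esum_esum _ _ _ _ _ (fun j l => (volume (a j l) (b j l))%:E)); last first.
  by move=> j l _ _; rewrite lee_fin.
apply: (@le_trans _ _ (\esum_(j in [set: J]) (e j)%:E)%E).
  apply: le_esum => j _; have [_ _] := abP j.
  by rewrite nneseries_esumT => [//|l]; rewrite lee_fin vol0.
rewrite -(@esum_image _ _ _ _ pickle (fun l => (eps / (2 ^ l.+1)%:R)%:E)); last first.
  by move=> i j _ _; exact: (pcan_inj pickleK_inv).
apply: le_trans (epsilon_trick0 xpredT (ltW eps0)).
rewrite nneseries_esumT => [|l]; last by rewrite lee_fin divr_ge0 // ltW.
rewrite esum_mkcond; apply: le_esum => l _; case: ifP => // _.
by rewrite lee_fin divr_ge0 // ltW.
Qed.

Lemma lebesgue_null_finite_cover (k0 : K) D :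
  (forall eps : R, 0 < eps -> exists (I : finType) (a b : I -> K -> R),
    [/\ forall i k, a i k <= b i k, D `<=` \bigcup_i box (a i) (b i) &
        \sum_i volume (a i) (b i) <= eps]) ->
  lebesgue_null D.
Proof.
move=> H; apply: (lebesgue_null_cover k0) => eps /H[I [a [b [ab Dab vol]]]].
exists I, a, b; split => //.
rewrite esum_fset; last 2 first.
- exact: finite_finset.
- by move=> i _; rewrite lee_fin volume_ge0.
rewrite (_ : [set: I] = [set` index_enum I]).
  by rewrite -fsbig_seq ?index_enum_uniq // sumEFin lee_fin.
by apply/seteqP; split => i //= _; exact: mem_index_enum.
Qed.

(* Over each of the [M ^ (#|K| - 1)] cells of side [r / M] of the coordinates
   other than [k], the graph lies in an interval of length [O(1 / M)]. *)
Lemma lebesgue_null_lipschitz_graph (k : K) (c : K -> R) (r L : R) D :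
  0 < r -> 0 <= L ->
  (forall x, D x -> forall l, c l <= x l < c l + r) ->
  (forall x y d, 0 <= d -> D x -> D y -> (forall l, l != k -> `|y l - x l| <= d) ->
     `|y k - x k| <= L * d) ->
  lebesgue_null D.
Proof.
move=> r0 L0 Dc DL; apply: (lebesgue_null_finite_cover k) => eps eps0.
pose S := {l : K | l != k}; pose n := #|[pred l : K | l != k]|.
(* The [M ^ n] boxes of volume [2 * L * h ^+ n.+1], with [h = r / M], have total volume
   [C * eps / M]. *)
set C := 2 * L * r ^+ n.+1 / eps.
pose M := (Num.truncn C).+1.
have CM : C <= M%:R by apply: ltW; exact: truncnS_gt.
have M0 : 0 < M%:R :> R by rewrite ltr0n.
set h := r / M%:R; have h0 : 0 < h by rewrite divr_gt0.
pose I : finType := {ffun S -> 'I_M}.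
pose idx (f : I) (l : K) : R := if insub l is Some s then (f s : nat)%:R else 0.
pose cell (f : I) (x : K -> R) :=
  forall l, l != k -> c l + idx f l * h <= x l <= c l + (idx f l + 1) * h.
(* A point of [D] over each cell that has one; over the other cells the value [c] is arbitrary, as
   there is no point of [D] to cover. *)
have /choice[z zP] (f : I) : exists x, forall y, D y -> cell f y -> D x /\ cell f x.
  have [[x [Dx fx]]|nx] := pselect (exists x, D x /\ cell f x); first by exists x.
  by exists c => y Dy fy; case: nx; exists y.
pose a f l := if l == k then z f k - L * h else c l + idx f l * h.
pose b f l := if l == k then z f k + L * h else c l + (idx f l + 1) * h.
exists I, a, b; split.
- move=> f l; rewrite /a /b; case: eqP => _.
    by rewrite lerD2l ge0_cp // mulr_ge0 // ltW.
  by rewrite lerD2l ler_pM2r // lerDl.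
- move=> x Dx.
  have iP (s : S) : exists i : 'I_M, i%:R <= (x (val s) - c (val s)) / h <= i%:R + 1.
    have /andP[cx xc] := Dc x Dx (val s).
    have t0 : 0 <= (x (val s) - c (val s)) / h by rewrite divr_ge0 ?subr_ge0 // ltW.
    have /andP[t1 t2] := truncn_itv t0.
    have tM : (Num.truncn ((x (val s) - c (val s)) / h) < M)%N.
      rewrite -(ltr_nat R); apply: le_lt_trans t1 _.
      rewrite ltr_pdivrMr // /h mulrC divfK ?gt_eqF //.
      by rewrite ltrBlDl.
    by exists (Ordinal tM); rewrite t1 /= -natr1 in t2 *; exact: ltW.
  have /choice[g gP] := iP; pose f : I := finfun g.
  have fx : cell f x.
    move=> l lk; rewrite /idx insubT ffunE.
    have /andP[] := gP (Sub l lk); rewrite /= ler_pdivlMr // ler_pdivrMr //.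
    by move=> H1 H2; apply/andP; split; lra.
  exists f => // l; rewrite /a /b; case: eqP => [->|/eqP lk]; last exact: fx.
  have [Dz fz] := zP f x Dx fx.
  rewrite -ler_distlC distrC; apply: DL => [|//|//|l' l'k]; first exact: ltW.
  have := fx l' l'k; have := fz l' l'k; rewrite ler_norml mulrDl mul1r.
  by move: (idx f l' * h) => ?; lra.
- have volE f : volume (a f) (b f) = 2 * L * h ^+ n.+1.
    rewrite /volume (bigD1 k) //= /a /b eqxx.
    rewrite (_ : _ - _ = 2 * L * h); last by ring.
    rewrite (eq_bigr (fun=> h)) => [|l lk]; last first.
      by rewrite (negbTE lk) mulrDl mul1r; lra.
    by rewrite prodr_const exprS -/n; ring.
  under eq_bigr do rewrite volE.
  rewrite sumr_const card_ffun card_ord card_sig -/n.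
  rewrite -[leLHS]mulr_natl natrX.
  move: CM; rewrite /C ler_pdivrMr // => CM.
  have Mn : M%:R != 0 :> R by rewrite gt_eqF.
  rewrite (_ : _ * _ = 2 * L * r ^+ n.+1 / M%:R); first by rewrite ler_pdivrMr // [eps * _]mulrC.
  rewrite /h expr_div_n !exprS invfM; move: (M%:R) Mn (r ^+ n) => u u0 rn.
  have un : u ^+ n != 0 by rewrite expf_neq0.
  by move: (u ^+ n) un => un un0; field; rewrite u0.
Qed.

(** * Zero sets of polynomials as countable unions of Lipschitz graphs *)

(** Constants and variables satisfy such estimates, and sums and products inherit them; the bounds
    on [P] and on its derivative are carried along for the product. Only the direction [k] is
    expanded, the other increments enter through their bound [d]. *)
Lemma taylor_estimate (n : nat) (P : mpoly n R) (k : 'I_n) (B : R) : 0 <= B ->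
  exists C : R, 0 <= C /\ forall (x y : 'I_n -> R) (d : R),
    (forall l, `|x l| <= B) -> (forall l, `|y l| <= B) ->
    0 <= d -> (forall l, l != k -> `|y l - x l| <= d) ->
    [/\ `|meval x P| <= C, `|meval x (mderiv k P)| <= C &
        `|meval y P - meval x P - meval x (mderiv k P) * (y k - x k)|
          <= C * ((y k - x k) ^+ 2 + d)].
Proof.
move=> B0.
pose good (Q : mpoly n R) := exists2 C : R, 0 <= C & forall (x y : 'I_n -> R) (d : R),
    (forall l, `|x l| <= B) -> (forall l, `|y l| <= B) ->
    0 <= d -> (forall l, l != k -> `|y l - x l| <= d) ->
    [/\ `|meval x Q| <= C, `|meval x (mderiv k Q)| <= C &
        `|meval y Q - meval x Q - meval x (mderiv k Q) * (y k - x k)|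
          <= C * ((y k - x k) ^+ 2 + d)].
have goodC c : good (mpolyC n c).
  exists `|c| => // x y d xB yB d0 xy.
  rewrite mderivC meval0 !mevalC normr0 subrr mul0r subrr normr0; split => //.
  by rewrite mulr_ge0 // addr_ge0 // sqr_ge0.
have goodX i : good (mpolyX R (mnm1 i)).
  exists (B + 1) => [|x y d xB yB d0 xy]; first lra.
  have ki : mderiv k (mpolyX R (mnm1 i)) = mpolyC n (i == k)%:R.
    rewrite mderivX mnm1E; have [->|ik] := eqVneq i k; last by rewrite scale0r mpolyC0.
    rewrite scale1r (_ : mnm_sub _ _ = mnm0) ?mpolyX0 //.
    by apply/mnmP => j; rewrite mnmBE subnn mnm0E.
  rewrite ki mevalC !mevalXU; split.
  - by apply: le_trans (xB i) _; lra.
  - by case: eqP => _; rewrite ?normr1 ?normr0; lra.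
  have s0 : 0 <= (y k - x k) ^+ 2 by exact: sqr_ge0.
  have [->|ik] := eqVneq i k.
    by rewrite mul1r subrr normr0 mulr_ge0 // addr_ge0.
  rewrite mul0r subr0; apply: le_trans (xy i ik) _.
  by rewrite -[leLHS]mul1r ler_pM //; lra.
have goodD Q1 Q2 : good Q1 -> good Q2 -> good (Q1 + Q2).
  move=> [C1 C10 H1] [C2 C20 H2]; exists (C1 + C2) => [|x y d xB yB d0 xy].
    exact: addr_ge0.
  have [a1 b1 c1] := H1 x y d xB yB d0 xy; have [a2 b2 c2] := H2 x y d xB yB d0 xy.
  rewrite mderivD !mevalD; split; try by apply: le_trans (ler_normD _ _) _; exact: lerD.
  rewrite [leRHS]mulrDl; apply: le_trans _ (lerD c1 c2); apply: le_trans _ (ler_normD _ _).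
  by rewrite le_eqVlt; apply/orP; left; apply/eqP; congr (`|_|); ring.
have goodM Q1 Q2 : good Q1 -> good Q2 -> good (Q1 * Q2).
  move=> [C1 C10 H1] [C2 C20 H2]; exists (C1 * C2 * (3 + 2 * B)) => [|x y d xB yB d0 xy].
    by rewrite mulr_ge0 ?mulr_ge0 //; lra.
  have [a1 b1 c1] := H1 x y d xB yB d0 xy; have [a2 b2 c2] := H2 x y d xB yB d0 xy.
  have [a2' _ _] := H2 y x d yB xB d0 (fun l lk => ltac:(by rewrite distrC; exact: xy)).
  rewrite mderivM mevalD !mevalM.
  move: a1 b1 c1 a2 b2 c2 a2'.
  set p := meval x Q1; set p' := meval y Q1; set pk := meval x (mderiv k Q1).
  set q := meval x Q2; set q' := meval y Q2; set qk := meval x (mderiv k Q2).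
  set D := y k - x k; set s := D ^+ 2 + d.
  move=> a1 b1 c1 a2 b2 c2 a2'.
  have D2 : `|D| <= 2 * B.
    by apply: le_trans (ler_normB _ _) _; have := yB k; have := xB k; lra.
  have DD : `|D| * `|D| <= s by rewrite -normrM ger0_norm -expr2 ?sqr_ge0 // /s lerDl.
  have s0 : 0 <= s by rewrite addr_ge0 // sqr_ge0.
  have CC : 0 <= C1 * C2 by exact: mulr_ge0.
  split.
  - rewrite normrM; apply: le_trans (ler_pM _ _ a1 a2) _ => //.
    by rewrite -[leLHS]mulr1 ler_wpM2l //; lra.
  - apply: le_trans (ler_normD _ _) _; rewrite !normrM.
    apply: le_trans (lerD (ler_pM _ _ b1 a2) (ler_pM _ _ a1 b2)) _ => //.
    rewrite (_ : C1 * C2 + C1 * C2 = C1 * C2 * 2); last by ring.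
    by rewrite ler_wpM2l //; lra.
  (* A Leibniz expansion of the error. With [|D| <= 2 * B] the three summands are at most
     [C1 * C2 * s], [C1 * C2 * s] and [(1 + 2 * B) * C1 * C2 * s], whence the factor [3 + 2 * B]. *)
  rewrite (_ : _ - _ = (p' - p - pk * D) * q' + p * (q' - q - qk * D)
     + pk * (qk * (D * D) + D * (q' - q - qk * D))); last by ring.
  apply: le_trans (ler_normD _ _) _.
  rewrite (_ : _ * s = (C1 * s * C2 + C1 * (C2 * s)) + C1 * (C2 * s + 2 * B * (C2 * s)));
    last by ring.
  apply: lerD.
    apply: le_trans (ler_normD _ _) _; rewrite !normrM.
    by apply: lerD; apply: ler_pM.
  rewrite normrM; apply: ler_pM => //.
  apply: le_trans (ler_normD _ _) _; rewrite !normrM.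
  by apply: lerD; apply: ler_pM => //; rewrite mulr_ge0.
have goodXm m : good (mpolyX R m).
  rewrite mpolyXE_id; apply: (big_ind good) => [||i _].
  - exact: (goodC 1).
  - exact: goodM.
  - by elim: (m i) => [|j IH]; [exact: (goodC 1)|rewrite exprS; exact: goodM].
suff : good P by move=> [C C0 CP]; exists C.
elim/mpolyind: P => [|c m Q _ _ IH]; first by rewrite -mpolyC0.
by apply: goodD => //; rewrite -mul_mpolyC; exact: goodM.
Qed.

Lemma lebesgue_null0 (k0 : K) : lebesgue_null (@set0 (K -> R)).
Proof.
apply: (lebesgue_null_finite_cover k0) => eps eps0.
exists 'I_0, (fun=> fun=> 0), (fun=> fun=> 0); split => //.
by rewrite big_ord0 ltW.
Qed.

(** A quantitative implicit function theorem: where the derivative is at least [1 / N] in absolute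
    value, the zeros in a sufficiently small cube form a Lipschitz graph over the coordinates other
    than [k]. Countably many [N] and cubes exhaust the set. *)
Lemma lebesgue_null_regular_zeros (P : mpoly #|K| R) (k : K) :
  lebesgue_null [set x | peval P x = 0 /\ peval (mderiv (enum_rank k) P) x != 0].
Proof.
pose i := enum_rank k.
have /choice[C CP] := fun N : nat => taylor_estimate P i (ler0n R N).
(* Then [N * C N * r N <= 1 / 2]: on a cube of this side the quadratic error is at most half of
   [|y k - x k|], and absorbing it leaves the Lipschitz constant [2 * N * C N]. *)
pose r N : R := (2 * N%:R * C N + 1)^-1.
have r0 N : 0 < r N.
  by have [C0 _] := CP N; rewrite invr_gt0 ltr_wpDl // !mulr_ge0.
pose F (J : nat * {ffun K -> int}) : set (K -> R) :=
  [set x | [/\ peval P x = 0, forall l, `|x l| <= J.1%:R,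
     1 <= J.1%:R * `|peval (mderiv i P) x| &
     forall l, (J.2 l)%:~R * r J.1 <= x l < (J.2 l)%:~R * r J.1 + r J.1]].
apply: (@lebesgue_null_sub _ (\bigcup_J F J)); last first.
  apply: (lebesgue_null_bigcup k) => -[N j]; have [C0 est] := CP N.
  apply: (@lebesgue_null_lipschitz_graph k (fun l => (j l)%:~R * r N) (r N) (2 * N%:R * C N)).
  - exact: r0.
  - by rewrite !mulr_ge0.
  - by move=> x [].
  move=> x y d d0 [/= Px xN xd xj] [/= Py yN _ yj] xy.
  have [l|l|//|l li|_ _] := est (fun l => x (enum_val l)) (fun l => y (enum_val l)) d.
  - exact: xN.
  - exact: yN.
  - by apply: xy; apply: contraNneq li => lk; rewrite /i -lk enum_valK.
  rewrite -/(peval P x) -/(peval P y) -/(peval _ x) Px Py subrr sub0r normrN enum_rankK normrM.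
  move: xd; set D := y k - x k; set p := `|peval _ _| => xd est1.
  have Dr : `|D| <= r N.
    by have := xj k; have := yj k; rewrite ler_norml /D; move: (_ * r N) => u; lra.
  have D2 : D ^+ 2 <= r N * `|D| by rewrite -real_normK ?num_real // expr2 ler_wpM2r.
  have : `|D| <= N%:R * (C N * (r N * `|D| + d)).
    apply: le_trans (_ : N%:R * (p * `|D|) <= _).
      by rewrite mulrA -[leLHS]mul1r ler_wpM2r.
    by rewrite ler_wpM2l // (le_trans est1) // ler_wpM2l // lerD2r.
  have rC : 2 * (N%:R * C N * r N) <= 1.
    rewrite (_ : 2 * _ = 2 * N%:R * C N * r N); last by ring.
    rewrite /r ler_pdivrMr ?mul1r ?lerDl //.
    by rewrite ltr_wpDl // !mulr_ge0.
  have : N%:R * C N * r N * `|D| * 2 <= `|D|.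
    by rewrite mulrAC [_ * 2]mulrC -[leRHS]mul1r ler_wpM2r.
  move: {est1 Dr D2} (`|D|) => a; lra.
move=> x [Px0 Px'].
have [N NP] : exists N : nat, (forall l, `|x l| <= N%:R) /\
    1 <= N%:R * `|peval (mderiv i P) x|.
  pose u := \sum_l `|x l| + `|peval (mderiv i P) x|^-1.
  have le_u v : v <= u -> v <= (Num.truncn u).+1%:R.
    by move=> vu; apply: le_trans vu _; apply: ltW; exact: truncnS_gt.
  exists (Num.truncn u).+1; split=> [l|].
    apply: le_u; rewrite /u (bigD1 l) //= -addrA lerDl addr_ge0 ?invr_ge0 //.
    exact: sumr_ge0.
  rewrite -ler_pdivrMr ?normr_gt0 // div1r; apply: le_u.
  by rewrite /u lerDr sumr_ge0.
exists (N, [ffun l => Num.floor (x l / r N)]) => //; split => //=; try by case: NP.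
move=> l; rewrite ffunE.
have /andP[f1 f2] := floor_itv (x l / r N).
rewrite ler_pdivlMr // in f1; rewrite ltr_pdivrMr // in f2.
by rewrite f1 /= (lt_le_trans f2) // intrD mulrDl mul1r.
Qed.

Lemma msize_mderiv (n : nat) (P : mpoly n R) (k : 'I_n) :
  P != 0 -> (msize (mderiv k P) < msize P)%N.
Proof.
move=> P0; have sP : (0 < msize P)%N by rewrite lt0n msize_poly_eq0.
rewrite -(prednK sP) ltnS [msize (mderiv k P)]msizeE.
apply/bigmax_leqP_seq => m mP _; rewrite -ltnS prednK //.
have : mnm_add m (mnm1 k) \in msupp P.
  move: mP; rewrite !mcoeff_msupp mcoeff_deriv.
  by apply: contraNneq => ->; rewrite mul0rn.
by move/msize_mdeg_lt; rewrite mdegD mdeg1 addn1.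
Qed.

(** Induction on the size of [P]. With respect to a nonzero partial derivative, a zero of [P] is
    either regular or a zero of this derivative, which has smaller size. If all partial derivatives
    vanish, [P] is a nonzero constant. *)
Lemma lebesgue_null_zeros (k0 : K) (P : mpoly #|K| R) :
  P != 0 -> lebesgue_null [set x | peval P x = 0].
Proof.
have [s] := ubnP (msize P); elim: s P => // s IH P Ps P0.
have [/existsP[i Pi]|/existsPn Pi] := boolP [exists i, mderiv i P != 0].
  apply: (@lebesgue_null_sub _ (\bigcup_(b : bool) if b
    then [set x | peval (mderiv i P) x = 0]
    else [set x | peval P x = 0 /\ peval (mderiv i P) x != 0])).
    move=> x Px; have [P'x|P'x] := eqVneq (peval (mderiv i P) x) 0.
      by exists true.
    by exists false.
  apply: (lebesgue_null_bigcup k0) => -[].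
    by apply: IH => //; rewrite -ltnS (leq_trans _ Ps) // ltnS msize_mderiv.
  by rewrite -[i]enum_valK; exact: lebesgue_null_regular_zeros.
apply: lebesgue_null_sub (lebesgue_null0 k0) => x /= Px.
have PC : P = mpolyC #|K| (mcoeff mnm0 P).
  apply/mpolyP => m; rewrite mcoeffC; have [->|m0] := eqVneq m mnm0; first by rewrite mulr1.
  rewrite mulr0; have [i mi] : exists i, m i != 0%N.
    by apply/existsP; apply: contraNT m0 => /existsPn m0; apply/eqP/mnmP => i;
       rewrite mnm0E; apply/eqP; rewrite -[_ == _]negbK m0.
  have := Pi i; rewrite negbK => /eqP/(congr1 (mcoeff (mnm_sub m (mnm1 i)))).
  rewrite mcoeff0 mcoeff_deriv submK; last first.
    by apply/mnm_lepP => j; rewrite mnm1E; case: eqP => [<-|]; rewrite // lt0n.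
  by move/eqP; rewrite mulrn_eq0 /= => /eqP.
move: Px P0; rewrite PC /peval mevalC => ->.
by rewrite mpolyC0 eqxx.
Qed.

End NullSets.

(** * Forests and hyperplane forms *)

Lemma union_of_trees_sub (V : finType) (E E' : {set V * V}) :
  E' \subset E -> union_of_trees E -> union_of_trees E'.
Proof.
move=> /fintype.subsetP E'E treeE c c2 /andP[cyc uc]; apply: (treeE c c2); rewrite /ucycle uc andbT.
by apply: sub_cycle cyc => j k /orP[] /E'E; rewrite /edge_rel => ->; rewrite ?orbT.
Qed.

(** Induction on the number of edges. Deleting the edge [(j, k)] of a forest separates [j] from [k],
    so a potential for the remaining edges can be shifted by a constant on the component of [j]
    until it fits this edge too. *)
Lemma union_of_trees_potential (R : zmodType) (V : finType) (E : {set V * V})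
    (y : V * V -> R) :
  (forall j k, (j, k) \in E -> (k, j) \notin E) -> union_of_trees E ->
  exists u : V -> R, forall j k, (j, k) \in E -> u j - u k = y (j, k).
Proof.
have [N] := ubnP #|E|; elim: N E => // N IH E EN Easym treeE.
have [->|[[j k] jkE]] := set_0Vmem E.
  by exists (fun=> 0) => j k; rewrite inE.
set E' := E :\ (j, k).
have E'E : E' \subset E by exact: subD1set.
have [||u uE'] := IH E' _ _ (union_of_trees_sub E'E treeE).
- by move: EN; rewrite (cardsD1 (j, k) E) jkE.
- by move=> a b /(fintype.subsetP E'E)/Easym; apply: contra; move/(fintype.subsetP E'E).
have symE' : connect_sym (edge_rel E').
  by apply: sym_connect_sym => a b; rewrite /edge_rel orbC.
have njk : ~~ connect (edge_rel E') j k.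
  apply/negP => /connectP[p' pp' lp']; have := lp'.
  case/shortenP: pp' => p pp up _ lp {lp' p'}.
  apply: (treeE (j :: p)).
    (* Cycles have at least three vertices by definition; shorter paths would yield a loop or the
       reversed edge, which [Easym] excludes. *)
    case: p pp up lp => [|a [|b p]] //=.
      by move=> _ _ jk; move: jkE (Easym _ _ jkE); rewrite jk => ->.
    rewrite andbT => + _ ka; rewrite -ka /edge_rel !inE eqxx /= => /andP[_ kjE].
    by move: (Easym _ _ jkE); rewrite kjE.
  rewrite /ucycle up andbT /= rcons_path -lp {2}/edge_rel jkE orbT andbT.
  by apply: sub_path pp => a b; rewrite /edge_rel !inE => /orP[] /andP[_ ->]; rewrite ?orbT.
pose c := y (j, k) - (u j - u k).
exists (fun x => u x + if connect (edge_rel E') j x then c else 0) => a b abE.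
have [[-> ->]|ab] := eqVneq (a, b) (j, k).
  by rewrite connect0 (negbTE njk) addr0 addrAC /c addrC subrK.
have abE' : (a, b) \in E' by rewrite !inE ab.
have -> : connect (edge_rel E') j b = connect (edge_rel E') j a.
  apply: (same_connect_r symE'); rewrite symE'; apply: connect1.
  by rewrite /edge_rel abE'.
by rewrite opprD addrACA subrr addr0 uE'.
Qed.

Lemma surjective_or_dependent (R : fieldType) (D K : finType) (A : D -> K -> R) :
  (forall y : K -> R, exists w : D -> R, forall k, \sum_d w d * A d k = y k) \/
  (exists2 b : K -> R, (exists k, b k != 0) & forall d, \sum_k A d k * b k = 0).
Proof.
pose M : 'M[R]_(#|D|, #|K|) := \matrix_(d, k) A (enum_val d) (enum_val k).
have [/row_fullP[N NM]|Mfull] := boolP (row_full M); [left|right].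
  move=> y; pose w := (\row_k y (enum_val k)) *m N.
  exists (fun d => w 0 (enum_rank d)) => k.
  have /rowP/(_ (enum_rank k)) : w *m M = \row_k y (enum_val k).
    by rewrite -mulmxA NM mulmx1.
  rewrite !mxE enum_rankK => <-; rewrite [LHS]big_enum_val.
  by apply: eq_bigr => d _; rewrite !mxE enum_valK enum_rankK.
have /rowV0Pn[b /sub_kermxP bM b0] : kermx M^T != 0.
  rewrite kermx_eq0; apply: contra Mfull.
  by rewrite /row_free /row_full mxrank_tr.
exists (fun k => b 0 (enum_rank k)).
  have /rV0Pn[k bk] := b0; exists (enum_val k); by rewrite enum_valK.
move=> d; have /rowP/(_ (enum_rank d)) := bM; rewrite !mxE => bd.
rewrite -[RHS]bd [LHS]big_enum_val.
by apply: eq_bigr => k _; rewrite !mxE enum_valK enum_rankK mulrC.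
Qed.

Section HyperplaneForms.
Variables (R : realType) (k : nat).
Implicit Types (o : option 'I_k.+1) (w g : 'rV[R]_k.+1) (T : {set option 'I_k.+1}).

(** [None] is the hyperplane at infinity: a line meets the affine space of vectors with coordinate
    sum 1 unless its coordinate sum is 0. *)
Definition hyp_form o w : R := if o is Some j then w 0 j else \sum_j w 0 j.

Lemma hyp_form_linear o a w1 w2 :
  hyp_form o (a *: w1 + w2) = a * hyp_form o w1 + hyp_form o w2.
Proof.
case: o => [j|] /=; rewrite ?mxE // mulr_sumr -big_split /=.
by apply: eq_bigr => j _; rewrite !mxE.
Qed.

Lemma hyp_form_coefE o w : hyp_form o w = \sum_j w 0 j * hyp_form o (delta_mx 0 j).
Proof.
case: o => [j|] /=.
  by rewrite (bigD1 j) //= mxE !eqxx mulr1 big1 ?addr0 // => l /negbTE lj;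
     rewrite mxE eq_sym lj andbF mulr0.
apply: eq_bigr => j _; rewrite (bigD1 j) //= mxE !eqxx big1 ?addr0 ?mulr1 //.
by move=> l /negbTE lj; rewrite mxE lj andbF.
Qed.

(* Any [k + 1] of the [k + 2] forms are linearly independent, and the forms
   vanishing at a nonzero vector omit some coordinate form. *)
Lemma hyp_form_surjective T g (y : option 'I_k.+1 -> R) : g != 0 ->
  (forall o, o \in T -> hyp_form o g = 0) ->
  exists w, forall o, o \in T -> hyp_form o w = y o.
Proof.
move=> /rV0Pn[a ga] gT.
have aT : Some a \notin T by apply: contra ga => /gT /= ->.
pose w := \row_j (if j == a then y None - \sum_(l | l != a) y (Some l) else y (Some j)).
exists w => -[j|] oT /=.
  by rewrite mxE; case: eqP oT => // ->; rewrite (negbTE aT).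
rewrite (bigD1 a) //= mxE eqxx (eq_bigr (fun j => y (Some j))) ?subrK //.
by move=> j /negbTE ja; rewrite mxE ja.
Qed.

(** A linear parametrization of an intersection of hyperplanes, which makes the points on it
    polynomial functions of free coordinates. *)
Lemma hyp_kernel_basis T : exists d (B : 'M[R]_(d, k.+1)), row_free B /\
  forall w, (forall o, o \in T -> hyp_form o w = 0) <-> exists x, w = x *m B.
Proof.
pose S : 'M[R]_(k.+1, #|{: option 'I_k.+1}|) := \matrix_(j, o)
  (if enum_val o \in T then hyp_form (enum_val o) (delta_mx 0 j) else 0).
exists _, (row_base (kermx S)); split; first exact: row_base_free.
move=> w; transitivity (w *m S = 0).
  split=> [wT|wS o oT].
    apply/rowP => o; rewrite !mxE.
    have [oT|oT] := boolP (enum_val o \in T).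
      rewrite -[RHS](wT _ oT) hyp_form_coefE.
      by apply: eq_bigr => j _; rewrite mxE oT.
    by rewrite big1 // => j _; rewrite mxE (negbTE oT) mulr0.
  have /rowP/(_ (enum_rank o)) := wS; rewrite !mxE => {1}<-.
  rewrite hyp_form_coefE; apply: eq_bigr => j _.
  by rewrite mxE enum_rankK oT.
split=> [/sub_kermxP wS|[x ->]]; first by apply/submxP; rewrite eq_row_base.
by apply/sub_kermxP; rewrite -(eq_row_base (kermx S)) submxMl.
Qed.

End HyperplaneForms.

(** * Multilinear forms *)

Lemma sum_dffun_prod (R : comNzRingType) (I : finType) (T : I -> finType)
    (F : forall i, T i -> R) :
  \sum_(s : {dffun forall i, T i}) \prod_i F i (s i) = \prod_i \sum_a F i a.
Proof.
pose P i : {ffun T i -> R} := [ffun a => F i a].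
transitivity (\sum_(t : fprod T) \prod_(i in I) P i (t i)).
  rewrite (reindex (@dffun_of_fprod _ T)); last exact/onW_bij/dffun_of_fprod_bij.
  by apply: eq_bigr => t _; apply: eq_bigr => i _; rewrite !ffunE.
rewrite big_fprod; symmetry.
under eq_bigr do rewrite (big_tag F).
rewrite bigA_distr_big_dep; apply: eq_big => // g /familyP gT.
apply: eq_bigr => i _; have gi := eqP (gT i : tag (g i) == i).
by rewrite !untagE ffunE.
Qed.

Section MultilinearForms.
Variables (R : realType) (m : nat) (n : 'I_m -> nat).
Notation profile := (profile n).
Notation mixed := (mixed R n).
Implicit Types (tau : profile -> R) (g : mixed) (s : profile).

Definition mform tau g : R := \sum_(s : profile) (\prod_k g k 0 (s k)) * tau s.

Definition setf g (l : 'I_m) (w : 'rV[R]_(n l).+1) : mixed := eqtype.dfwith g w.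

Definition upd s (i : 'I_m) (j : 'I_(n i).+1) : profile :=
  [ffun l => eqtype.dfwith (fun k => s k) j l].

Lemma setf_in g l (w : 'rV[R]_(n l).+1) : setf g w l = w.
Proof. exact: eqtype.dfwith_in. Qed.

Lemma setf_out g l (w : 'rV[R]_(n l).+1) k : k != l -> setf g w k = g k.
Proof. by move=> kl; rewrite /setf eqtype.dfwith_out // eq_sym. Qed.

Lemma setf_eq g l (w : 'rV[R]_(n l).+1) (h : mixed) :
  h l = w -> (forall k, k != l -> h k = g k) -> setf g w = h.
Proof.
move=> hl hk; apply: functional_extensionality_dep => k.
have [->|kl] := eqVneq k l; first by rewrite setf_in.
by rewrite setf_out // hk.
Qed.

Lemma setf_id g l : setf g (g l) = g.
Proof. exact: setf_eq. Qed.

Lemma upd_in s i (j : 'I_(n i).+1) : upd s j i = j.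
Proof. by rewrite ffunE eqtype.dfwith_in. Qed.

Lemma upd_out s i (j : 'I_(n i).+1) k : k != i -> upd s j k = s k.
Proof. by move=> ki; rewrite ffunE eqtype.dfwith_out // eq_sym. Qed.

Lemma upd_eq s i (j : 'I_(n i).+1) (t : profile) :
  t i = j -> (forall k, k != i -> t k = s k) -> upd s j = t.
Proof.
move=> ti tk; apply/ffunP => k; have [->|ki] := eqVneq k i; first by rewrite upd_in.
by rewrite upd_out // tk.
Qed.

Lemma mform_setf tau g l (w : 'rV[R]_(n l).+1) :
  mform tau (setf g w) = \sum_(s : profile) w 0 (s l) * ((\prod_(k | k != l) g k 0 (s k)) * tau s).
Proof.
apply: eq_bigr => s _; rewrite (bigD1 l) //= setf_in -mulrA; congr (_ * (_ * _)).
by apply: eq_bigr => k kl; rewrite setf_out.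
Qed.

Lemma mform_linear tau g l a (u v : 'rV[R]_(n l).+1) :
  mform tau (setf g (a *: u + v)) = a * mform tau (setf g u) + mform tau (setf g v).
Proof.
rewrite !mform_setf mulr_sumr -big_split /=; apply: eq_bigr => s _.
by rewrite !mxE mulrDl !mulrA.
Qed.

Lemma mform_setf0 tau g l : mform tau (setf g (0 : 'rV[R]_(n l).+1)) = 0.
Proof. by rewrite mform_setf big1 // => s _; rewrite mxE mul0r. Qed.

Lemma mform_setfZ tau g l a (u : 'rV[R]_(n l).+1) :
  mform tau (setf g (a *: u)) = a * mform tau (setf g u).
Proof. by have := mform_linear tau g a u 0; rewrite mform_setf0 !addr0. Qed.

Lemma mform_scale tau g (mu : 'I_m -> R) :
  mform tau (fun k => mu k *: g k) = (\prod_k mu k) * mform tau g.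
Proof.
rewrite /mform mulr_sumr; apply: eq_bigr => s _; rewrite mulrA; congr (_ * _).
by rewrite -big_split; apply: eq_bigr => k _; rewrite mxE.
Qed.

Lemma mformD tau tau' g : mform (fun s => tau s + tau' s) g = mform tau g + mform tau' g.
Proof. by rewrite -big_split; apply: eq_bigr => s _; rewrite mulrDr. Qed.

Lemma mformB tau tau' g : mform (fun s => tau s - tau' s) g = mform tau g - mform tau' g.
Proof. by rewrite -sumrB; apply: eq_bigr => s _; rewrite mulrBr. Qed.

Lemma mformZ a tau g : mform (fun s => a * tau s) g = a * mform tau g.
Proof. by rewrite mulr_sumr; apply: eq_bigr => s _; rewrite mulrCA. Qed.

Lemma mform_sum (I : finType) (P : pred I) (F : I -> profile -> R) g :
  mform (fun s => \sum_(i | P i) F i s) g = \sum_(i | P i) mform (F i) g.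
Proof. by rewrite exchange_big; apply: eq_bigr => s _; rewrite mulr_sumr. Qed.

Lemma mform_prod (f : forall l, 'I_(n l).+1 -> R) g :
  mform (fun s => \prod_l f l (s l)) g = \prod_l \sum_a g l 0 a * f l a.
Proof.
rewrite -(sum_dffun_prod (fun l a => g l 0 a * f l a)).
by apply: eq_bigr => s _; rewrite -big_split.
Qed.

(** The value at a pure strategy of player [i] does not involve [g i]; multiplied by a coordinate of
    [g i] it becomes a form of degree 1 in every factor. The sum is reindexed by exchanging the
    entries [a] and [j] of the profiles. *)
Lemma mform_upd tau g i (a j : 'I_(n i).+1) :
  mform (fun s => (s i == a)%:R * tau (upd s j)) g = g i 0 a * mform tau (set_pure g j).
Proof.
transitivity (\sum_(s : profile | s i == a) (\prod_k g k 0 (s k)) * tau (upd s j)).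
  rewrite big_mkcond; apply: eq_bigr => s _.
  by case: eqP => _; rewrite ?mul1r // mul0r mulr0.
rewrite [X in _ * X](_ : _ = \sum_(s : profile | s i == j)
    (\prod_(k | k != i) g k 0 (s k)) * tau s); last first.
  rewrite -[mform _ _]/(mform tau (setf g (delta_mx 0 j))) mform_setf [RHS]big_mkcond.
  apply: eq_bigr => s _; rewrite mxE eqxx /= eq_sym.
  by rewrite eq_sym; case: eqP => _; rewrite ?mul1r // mul0r.
rewrite (reindex_onto (fun s => upd s a) (fun s => upd s j)); last first.
  by move=> s /eqP sa; apply: upd_eq => // k ki; rewrite upd_out.
rewrite mulr_sumr; apply: eq_big => [s|s].
  rewrite upd_in eqxx /=; apply/eqP/eqP => [<-|sj]; first by rewrite upd_in.
  by apply: upd_eq => // k ki; rewrite upd_out.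
case/andP => _ /eqP ->; rewrite mulrA; congr (_ * _).
rewrite (bigD1 i) //= upd_in; congr (_ * _).
by apply: eq_bigr => k ki; rewrite upd_out.
Qed.

Lemma mform_set_pure tau g i (a : 'I_(n i).+1) :
  mform tau (set_pure g a) = mform (fun s => (s i == a)%:R * tau s) (set_pure g a).
Proof.
rewrite -[set_pure g a]/(setf g (delta_mx 0 a)) !mform_setf; apply: eq_bigr => s _.
rewrite mxE /= [s i == a]eq_sym; case: eqP => _; rewrite ?mul0r ?mulr0 ?mul1r //.
Qed.

End MultilinearForms.

(** * Genericity of the utilities *)

Section UtilityDifferences.
Variables (R : realType) (m : nat) (n : 'I_m -> nat).
Notation profile := (profile n).
Notation mixed := (mixed R n).
Notation utilities := (utilities R n).

Definition edge : finType := {i : 'I_m & ('I_(n i).+1 * 'I_(n i).+1)%type}.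

Implicit Types (U V : utilities) (r : edge) (g h : mixed) (s : profile).

Definition Lam U r g : R :=
  VW U (tag r) (set_pure g (tagged r).1) - VW U (tag r) (set_pure g (tagged r).2).

(** The coefficients of [Lam U r]. They do not depend on the entry [s (tag r)], so inserting any
    pure strategy of the player [tag r] recovers [Lam U r]. *)
Definition lam_tensor U r s : R :=
  U (tag r, upd s (tagged r).1) - U (tag r, upd s (tagged r).2).

Lemma lambdaB U i (j k : 'I_(n i).+1) g :
  lambda U j g - lambda U k g = Lam U (Tagged _ (j, k)) g.
Proof. by rewrite /lambda /Lam /=; ring. Qed.

Lemma Lam_ext U r g h : (forall k, k != tag r -> g k = h k) -> Lam U r g = Lam U r h.
Proof. by move=> gh; rewrite /Lam !(set_pure_eq _ gh). Qed.

Lemma Lam_setf_tag U r g (w : 'rV[R]_(n (tag r)).+1) : Lam U r (setf g w) = Lam U r g.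
Proof. by apply: Lam_ext => k kr; rewrite setf_out. Qed.

Lemma set_pure_setf g l (w : 'rV[R]_(n l).+1) i (j : 'I_(n i).+1) :
  l != i -> set_pure (setf g w) j = setf (set_pure g j) w.
Proof.
move=> li; apply/esym/setf_eq => [|k kl]; first by rewrite [LHS](setf_out _ _ li) setf_in.
have [->|ki] := eqVneq k i; first by rewrite /set_pure !eqtype.dfwith_in.
by rewrite ![set_pure _ _ _](setf_out _ _ ki) setf_out.
Qed.

Lemma Lam_linear U r g l a (u v : 'rV[R]_(n l).+1) : l != tag r ->
  Lam U r (setf g (a *: u + v)) = a * Lam U r (setf g u) + Lam U r (setf g v).
Proof.
move=> lr; rewrite /Lam !set_pure_setf //.
rewrite -![VW U _ _]/(mform (fun s => U (tag r, s)) _) !mform_linear; ring.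
Qed.

Lemma Lam_setf0 U r g l : l != tag r -> Lam U r (setf g (0 : 'rV[R]_(n l).+1)) = 0.
Proof.
move=> lr; have := Lam_linear U g (-1) (0 : 'rV[R]_(n l).+1) 0 lr.
by rewrite scaler0 addr0 mulN1r addrC subrr.
Qed.

Lemma Lam_setfZ U r g l a (u : 'rV[R]_(n l).+1) : l != tag r ->
  Lam U r (setf g (a *: u)) = a * Lam U r (setf g u).
Proof.
by move=> lr; have := Lam_linear U g a u 0 lr; rewrite Lam_setf0 // !addr0.
Qed.

Lemma Lam_coord U r (a : 'I_(n (tag r)).+1) g :
  mform (fun s => (s (tag r) == a)%:R * lam_tensor U r s) g = g (tag r) 0 a * Lam U r g.
Proof.
rewrite mulrBr -!(mform_upd (fun s => U (tag r, s))) -mformB; congr mform.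
by apply/funext => s; rewrite mulrBr.
Qed.

Lemma Lam_mform U r (a : 'I_(n (tag r)).+1) g :
  Lam U r g = mform (lam_tensor U r) (set_pure g a).
Proof.
rewrite mform_set_pure Lam_coord [set_pure g a _]eqtype.dfwith_in mxE !eqxx mul1r.
by rewrite -[set_pure g a]/(setf g (delta_mx 0 a)) Lam_setf_tag.
Qed.

Lemma Lam_scale U r g (mu : 'I_m -> R) :
  Lam U r (fun k => mu k *: g k) = (\prod_(l | l != tag r) mu l) * Lam U r g.
Proof.
rewrite !(Lam_mform _ (tagged r).1).
have -> : set_pure (fun k => mu k *: g k) (tagged r).1 =
    fun k => (if k == tag r then 1 else mu k) *: set_pure g (tagged r).1 k.
  apply: setf_eq => [|k /negbTE kr].
    by rewrite eqxx scale1r /set_pure eqtype.dfwith_in.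
  by rewrite kr /set_pure eqtype.dfwith_out // eq_sym kr.
rewrite mform_scale (bigD1 (tag r)) //= eqxx mul1r; congr (_ * _).
by apply: eq_bigr => k /negbTE ->.
Qed.

Lemma VW_utilities_linear a U V i g :
  VW (fun k => a * U k + V k) i g = a * VW U i g + VW V i g.
Proof.
rewrite /VW mulr_sumr -big_split; apply: eq_bigr => s _ /=.
by rewrite mulrDr mulrCA.
Qed.

Lemma Lam_utilities_linear a U V r g :
  Lam (fun k => a * U k + V k) r g = a * Lam U r g + Lam V r g.
Proof. by rewrite /Lam !VW_utilities_linear; ring. Qed.

Section PolynomialDependence.
Variables (X : finType) (g : (X -> R) -> mixed).
Definition polyfun_mixed := forall l a, polyfun (fun t => g t l 0 a).
Hypothesis gP : polyfun_mixed.

Lemma polyfun_VW U i : polyfun (fun t => VW U i (g t)).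
Proof.
apply: polyfun_sum => s _; apply: polyfunM; last exact: polyfun_const.
by apply: polyfun_prod => k _; exact: gP.
Qed.

End PolynomialDependence.

Lemma polyfun_setf (X : finType) (g : (X -> R) -> mixed) l (w : 'rV[R]_(n l).+1) :
  polyfun_mixed g -> polyfun_mixed (fun t => setf (g t) w).
Proof.
move=> gP k a; have [E|kl] := eqVneq k l.
  rewrite {k}E in a *; apply: (polyfun_ext _ (polyfun_const X (w 0 a))) => t.
  by rewrite setf_in.
by apply: (polyfun_ext _ (gP k a)) => t; rewrite setf_out.
Qed.

Lemma polyfun_Lam (X : finType) (g : (X -> R) -> mixed) U r :
  polyfun_mixed g -> polyfun (fun t => Lam U r (g t)).
Proof.
move=> gP; apply: polyfunD; last apply: polyfunN; apply: polyfun_VW;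
  exact: polyfun_setf.
Qed.

(** * Parameter count for the degenerate utilities *)

Section Genericity.
Variables (Rs : {set edge}) (d : 'I_m -> nat) (B : forall l, 'M[R]_(d l, (n l).+1)).
Variables (c : forall l, 'I_(d l)) (r0 : edge).
Hypothesis B_free : forall l, row_free (B l).
Hypothesis r0Rs : r0 \in Rs.
Hypothesis solvable : forall i (y : 'I_(n i).+1 * 'I_(n i).+1 -> R),
  exists u : 'I_(n i).+1 -> R, forall jk, (Tagged _ jk : edge) \in Rs ->
    u jk.1 - u jk.2 = y jk.

(** The factor [l] occurs in some form [Lam U r] with [r] in [Rs]. Only such factors contribute
    parameters and equations. *)
Definition active (l : 'I_m) : bool := [exists r in Rs, tag r != l].

Definition pairing k (w : 'rV[R]_k) (f : 'I_k -> R) : R := \sum_a w 0 a * f a.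

Section Surjectivity.
Variables (x : forall l, 'rV[R]_(d l)) (b : edge -> R).
Hypothesis xc : forall l, x l 0 (c l) = 1.
Hypothesis b0 : forall r, r \in Rs -> b r != 0.
Let g : mixed := fun l => x l *m B l.

(* [v r * prod theta] has the prescribed value at [g], where [theta l] is a form
   equal to 1 at [g l]; the corrections [chi l], which vanish at [g l], adjust the
   derivative in the direction of the [l]-th factor and are each carried by one
   edge [rho l] of another player. *)
Lemma Lam_surjective (v : edge -> R) (psi : forall l, 'I_(d l) -> R) :
  exists U, (forall r, r \in Rs -> Lam U r g = v r) /\
    forall l (j : 'I_(d l)), active l -> j != c l ->
      \sum_(r in Rs | tag r != l) b r * Lam U r (setf g (row j (B l))) = psi l j.
Proof.
have [C BC] : {C : forall l, 'M[R]_((n l).+1, d l) | forall l, B l *m C l = 1%:M}.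
  by apply: cid; exists (fun l => sval (cid (row_freeP (B_free l)))) => l; case: cid.
have [rho rhoP] : {rho : 'I_m -> edge | forall l, active l -> rho l \in Rs /\ tag (rho l) != l}.
  apply: cid; exists (fun l => odflt r0 [pick r | (r \in Rs) && (tag r != l)]) => l.
  case/existsP => r rl; case: pickP => [r' /andP[]//|/(_ r)].
  by rewrite rl.
(* The columns of [C l] are dual to the rows of [B l]. Subtracting multiples of the column [c l]
   makes [chi l] vanish at [g l], where [x l 0 (c l) = 1], and does not change its values on the
   rows other than [c l]. *)
pose theta l a := C l a (c l).
pose chi l a := \sum_(j | j != c l) psi l j * (C l a j - C l a (c l) * x l 0 j).
have pairC l (w : 'rV[R]_(n l).+1) j : pairing w (fun a => C l a j) = (w *m C l) 0 j.
  by rewrite mxE.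
have pair_chi l (w : 'rV[R]_(n l).+1) : pairing w (chi l) =
    \sum_(j | j != c l) psi l j * ((w *m C l) 0 j - (w *m C l) 0 (c l) * x l 0 j).
  rewrite /pairing; under eq_bigr do rewrite mulr_sumr.
  rewrite exchange_big; apply: eq_bigr => j _ /=.
  rewrite -!pairC /pairing mulr_suml -sumrB mulr_sumr.
  by apply: eq_bigr => a _; ring.
have gC l : g l *m C l = x l by rewrite /g -mulmxA BC mulmx1.
have rowC l j : row j (B l) *m C l = delta_mx 0 j.
  by rewrite -row_mul BC row1.
have g_theta l : pairing (g l) (theta l) = 1 by rewrite pairC gC.
have g_chi l : pairing (g l) (chi l) = 0.
  by rewrite pair_chi gC big1 // => j _; rewrite xc mul1r subrr mulr0.
have row_theta l j : j != c l -> pairing (row j (B l)) (theta l) = 0.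
  by move=> jc; rewrite pairC rowC mxE eqxx eq_sym (negbTE jc).
have row_chi l j : j != c l -> pairing (row j (B l)) (chi l) = psi l j.
  move=> jc; rewrite pair_chi rowC (bigD1 j) //= big1 => [|k /andP[_ kj]].
    by rewrite !mxE !eqxx eq_sym (negbTE jc) mul0r subr0 mulr1 addr0.
  by rewrite !mxE eqxx (negbTE kj) eq_sym (negbTE jc) mul0r subr0 mulr0.
pose th r l : 'I_(n l).+1 -> R := if l == tag r then fun=> 1 else theta l.
pose thc r l := eqtype.dfwith (th r) (chi l).
pose M r s := v r * (\prod_l th r l (s l)) +
  \sum_(l | active l && (rho l == r)) (b r)^-1 * \prod_k thc r l k (s k).
have M_ext r (s t : profile) : (forall k, k != tag r -> t k = s k) -> M r t = M r s.
  move=> ts; rewrite /M; congr (_ * _ + _).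
    apply: eq_bigr => l _; rewrite /th; case: eqP => // /eqP lr.
    by rewrite ts.
  apply: eq_bigr => l /andP[/rhoP[_ rl] /eqP rhol]; congr (_ * _).
  have lr : l != tag r by rewrite -rhol eq_sym.
  apply: eq_bigr => k _; have [->|kr] := eqVneq k (tag r); last by rewrite ts.
  by rewrite /thc eqtype.dfwith_out // /th eqxx.
have [pot potP] : {pot : forall i, ('I_(n i).+1 * 'I_(n i).+1 -> R) -> 'I_(n i).+1 -> R |
    forall i y jk, (Tagged _ jk : edge) \in Rs -> pot i y jk.1 - pot i y jk.2 = y jk}.
  by apply: cid; exists (fun i y => sval (cid (solvable y))) => i y; case: cid.
(* The potential on the graph of the player [p.1], evaluated at this player's own strategy. The
   prescribed differences [M] do not depend on that strategy ([M_ext]), so they are the differences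
   of [U] along the edges. *)
pose U : utilities := fun p => pot p.1 (fun jk => M (Tagged _ jk) p.2) (p.2 p.1).
have UM r s : r \in Rs -> lam_tensor U r s = M r s.
  case: r => i jk rRs; rewrite /lam_tensor /U /= !upd_in.
  have MM j : (fun jk0 : 'I_(n i).+1 * 'I_(n i).+1 =>
      M (existT _ i jk0) (@upd _ _ s i j)) = (fun jk0 => M (existT _ i jk0) s).
    by apply/funext => jk0; apply: M_ext => k ki; rewrite upd_out.
  by rewrite !MM potP.
have LamE r h : r \in Rs -> Lam U r h =
    v r * (\prod_(l | l != tag r) pairing (h l) (theta l)) +
    \sum_(l | active l && (rho l == r)) (b r)^-1 * (pairing (h l) (chi l) *
       \prod_(k | (k != tag r) && (k != l)) pairing (h k) (theta k)).
  move=> rRs; set a := (tagged r).1; rewrite (Lam_mform U a).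
  rewrite (_ : lam_tensor U r = M r); last by apply/funext => s; exact: UM.
  have pure_r (f : 'I_(n (tag r)).+1 -> R) : pairing (set_pure h a (tag r)) f = f a.
    rewrite /pairing /set_pure eqtype.dfwith_in (bigD1 a) //= mxE !eqxx mul1r big1 ?addr0 //.
    by move=> k /negbTE ka; rewrite mxE ka andbF mul0r.
  have pure_out k : k != tag r -> set_pure h a k = h k by move=> kr; exact: setf_out.
  rewrite mformD mformZ mform_prod mform_sum; congr (_ * _ + _).
    rewrite (bigD1 (tag r)) //= -/(pairing _ _) pure_r /th eqxx mul1r.
    by apply: eq_bigr => l lr; rewrite (negbTE lr) pure_out.
  apply: eq_bigr => l /andP[/rhoP[_ rl] /eqP rhol]; rewrite mformZ mform_prod; congr (_ * _).
  have lr : l != tag r by rewrite -rhol eq_sym.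
  rewrite (bigD1 (tag r)) //= -/(pairing _ _) pure_r /thc eqtype.dfwith_out //.
  rewrite /th eqxx mul1r (bigD1 l) //= -/(pairing _ _) eqtype.dfwith_in pure_out //.
  congr (_ * _); apply: eq_bigr => k /andP[kr kl].
  rewrite eqtype.dfwith_out; last by rewrite eq_sym.
  by rewrite /th (negbTE kr) pure_out.
exists U; split=> [r rRs|l j lact jc].
  rewrite LamE // big1 ?mulr1 => [|l _]; last exact: g_theta.
  by rewrite big1 ?addr0 // => l _; rewrite g_chi mul0r mulr0.
have LamS r : r \in Rs -> tag r != l -> Lam U r (setf g (row j (B l))) =
    if rho l == r then (b r)^-1 * psi l j else 0.
  move=> rRs rl; rewrite LamE // (bigD1 l) //=; last by rewrite eq_sym.
  rewrite setf_in row_theta // mul0r mulr0 add0r.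
  have terms k : k != l -> pairing (setf g (row j (B l)) k) (chi k) = 0.
    by move=> kl; rewrite setf_out.
  case: ifP => rhol.
    rewrite (bigD1 l) /=; last by rewrite lact rhol.
    rewrite setf_in row_chi // big1 ?mulr1 => [|k /andP[_ kl]]; last by rewrite setf_out.
    by rewrite big1 ?addr0 // => k /andP[_ kl]; rewrite terms // mul0r mulr0.
  rewrite big1 // => k /andP[_ /eqP rhok]; rewrite terms ?mul0r ?mulr0 //.
  by apply/eqP => kl; move: rhol; rewrite -kl rhok eqxx.
have [rhoRs rhol] := rhoP l lact.
rewrite (bigD1 (rho l)) /=; last by rewrite rhoRs.
rewrite LamS // eqxx mulrA divff ?b0 // mul1r big1 ?addr0 // => r /andP[/andP[rRs rl] rr].
by rewrite LamS // eq_sym (negbTE rr) mulr0.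
Qed.

End Surjectivity.

(** A linear relation, with support exactly [Rs], between the differentials along the intersections
    of hyperplanes. The scalings of the factors and of the relation are normalized by [c] and [r0].
    A summand with [tag r = l] is [b r * Lam U r g], which is 0. *)
Definition degenerate : set utilities :=
  [set U | exists (x : forall l, 'rV[R]_(d l)) (b : edge -> R),
    [/\ (forall l, x l 0 (c l) = 1), b r0 = 1, (forall r, r \in Rs -> b r != 0),
        (forall r, r \in Rs -> Lam U r (fun l => x l *m B l) = 0) &
        (forall l j, \sum_(r in Rs) b r *
           Lam U r (setf (fun l => x l *m B l) (row j (B l))) = 0)]].

(* The parameters are the coordinates of [x] other than the normalized ones, and
   the [b r] with [r != r0]; there is one equation more than parameters, the one
   corresponding to [None] being [Lam U r0 g = 0]. *)
Lemma thin_degenerate : thin degenerate.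
Proof.
pose Z := {z : {l : 'I_m & 'I_(d l)} | (tagged z != c (tag z)) && active (tag z)}.
(* Parameters and equations share the index set [X]: an element of [Z] is a free coordinate and the
   derivative in its direction, an element of [S] is the coefficient [b r] and the equation
   [Lam U r g = 0]. *)
pose S := {r : edge | (r \in Rs) && (r != r0)}.
pose X : finType := (Z + S)%type; pose Y : finType := option X.
pose xt (t : X -> R) l : 'rV[R]_(d l) := \row_j
  (if j == c l then 1 else
   if insub (Tagged (fun l => 'I_(d l)) j) is Some z then t (inl (z : Z)) else 0).
pose bt (t : X -> R) r : R :=
  if r == r0 then 1 else if insub r is Some s then t (inr (s : S)) else 0.
pose gt t : mixed := fun l => xt t l *m B l.
pose L (y : Y) (t : X -> R) (U : utilities) : R :=
  match y with
  | None => Lam U r0 (gt t)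
  | Some (inr r) => Lam U (val r) (gt t)
  | Some (inl z) => \sum_(r in Rs | tag r != tag (val z))
      bt t r * Lam U r (setf (gt t) (row (tagged (val z)) (B (tag (val z)))))
  end.
have xtP l j : polyfun (fun t => xt t l 0 j).
  case E1 : (j == c l).
    by apply: (polyfun_ext _ (polyfun_const X 1)) => t; rewrite mxE E1.
  case E2 : (insub (Tagged (fun l => 'I_(d l)) j) : option Z) => [z|].
    by apply: (polyfun_ext _ (polyfun_var R (inl z))) => t; rewrite mxE E1 E2.
  by apply: (polyfun_ext _ (polyfun_const X 0)) => t; rewrite mxE E1 E2.
have btP r : polyfun (fun t => bt t r).
  rewrite /bt; case: eqP => _; first exact: polyfun_const.
  by case: insub => [s|]; [exact: (polyfun_var R (inr s))|exact: polyfun_const].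
have gtP : polyfun_mixed gt.
  move=> l a; apply: (@polyfun_ext _ _ (fun t => \sum_j xt t l 0 j * B l j a)).
    by move=> t; rewrite [RHS]mxE.
  by apply: polyfun_sum => j _; apply: polyfunM => //; exact: polyfun_const.
apply: thin_sub (thin_incidence (X := X) (Y := Y) (L := L) _ _ _).
- move=> U [x [b [xc br0 b0 Lam0 eqs]]].
  set g := (fun l => x l *m B l) in Lam0 eqs.
  pose t (p : X) : R := match p with
    inl z => x (tag (val z)) 0 (tagged (val z)) | inr r => b (val r) end.
  (* On an inactive factor [xt t l] and [x l] may differ, but there every [r] in [Rs] has
     [tag r = l], and [Lam U r] does not depend on this factor. *)
  have xtE l : active l -> xt t l = x l.
    move=> lact; apply/rowP => j; rewrite mxE; case: eqP => [->|/eqP jc]; first by rewrite xc.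
    by rewrite insubT /= ?jc.
  have btE r : r \in Rs -> bt t r = b r.
    move=> rRs; rewrite /bt; case: eqP => [->|/eqP rr0]; first by rewrite br0.
    by rewrite insubT /= ?rRs.
  have gtE r k : r \in Rs -> k != tag r -> gt t k = g k.
    move=> rRs kr; rewrite /gt xtE //; apply/existsP; exists r.
    by rewrite rRs eq_sym.
  have LamE r : r \in Rs -> Lam U r (gt t) = Lam U r g.
    by move=> rRs; apply: Lam_ext => k kr; exact: (gtE r).
  have xtc l : xt t l 0 (c l) = 1 by rewrite mxE eqxx.
  have bt0 r : r \in Rs -> bt t r != 0 by move=> rRs; rewrite btE // b0.
  exists t; split=> [[[z|r]|]|z] /=.
  + have := eqs (tag (val z)) (tagged (val z)).
    rewrite [X in X = _ -> _](bigID (fun r => tag r != tag (val z))) /=.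
    rewrite [X in _ + X]big1 ?addr0 => [eq0|r /andP[rRs /negbNE/eqP rz]].
      rewrite -[RHS]eq0; apply: eq_bigr => r /andP[rRs rz]; rewrite btE //; congr (_ * _).
      apply: Lam_ext => k kr; have [->|kz] := eqVneq k (tag (val z)); first by rewrite !setf_in.
      by rewrite !setf_out // (gtE r).
    rewrite (_ : Lam U r _ = 0) ?mulr0 // -[RHS](Lam0 r rRs); apply: Lam_ext => k kr.
    by rewrite setf_out // -rz.
  + have /andP[rRs _] := valP r; by rewrite LamE ?Lam0.
  + by rewrite LamE ?Lam0.
  pose v r := if r == r0 then z None else
    if insub r is Some s then z (Some (inr (s : S))) else 0.
  pose psi l (j : 'I_(d l)) := if insub (Tagged (fun l => 'I_(d l)) j) is Some s
    then z (Some (inl (s : Z))) else 0.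
  have [V [V1 V2]] := Lam_surjective xtc bt0 v psi.
  exists V => -[[p|r]|] /=.
  + have /andP[p1 p2] := valP p; rewrite V2 // /psi.
    by rewrite taggedK valK.
  + have /andP[rRs rr0] := valP r; by rewrite V1 // /v (negbTE rr0) valK.
  + by rewrite V1 // /v eqxx.
- by rewrite card_option.
- move=> [[z|r]|] t a U V /=; rewrite ?Lam_utilities_linear //.
  rewrite mulr_sumr -big_split; apply: eq_bigr => r _ /=.
  by rewrite Lam_utilities_linear; ring.
move=> [[z|r]|] U /=; try exact: polyfun_Lam.
apply: polyfun_sum => r _; apply: polyfunM => //.
exact/polyfun_Lam/polyfun_setf.
Qed.

End Genericity.
End UtilityDifferences.

(** * Regular utilities: transversality in homogeneous coordinates *)

Section RegularUtilities.
Variables (R : realType) (m : nat) (n : 'I_m -> nat).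
Notation mixed := (mixed R n).
Notation utilities := (utilities R n).
Notation edge := (edge n).

Lemma Lam_mulmx (U : utilities) (r : edge) (g : mixed) l k (x : 'rV[R]_k)
    (B : 'M[R]_(k, (n l).+1)) : l != tag r ->
  Lam U r (setf g (x *m B)) = \sum_j x 0 j * Lam U r (setf g (row j B)).
Proof.
move=> lr; rewrite mulmx_sum_row.
rewrite (big_morph (fun w : 'rV[R]_(n l).+1 => Lam U r (setf g w))
  (id1 := 0) (op1 := +%R)); last exact: Lam_setf0.
  by apply: eq_bigr => j _; rewrite Lam_setfZ.
by move=> u v; have := Lam_linear U g 1 u v lr; rewrite scale1r mul1r.
Qed.

(** The form in which the forest condition enters: differences along the edges can be prescribed
    freely. It passes to subsets of [Rs], such as the support of a relation. *)
Definition solvable_edges (Rs : {set edge}) : Prop :=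
  forall i (y : 'I_(n i).+1 * 'I_(n i).+1 -> R), exists u : 'I_(n i).+1 -> R,
    forall jk, (existT _ i jk : edge) \in Rs -> u jk.1 - u jk.2 = y jk.

(* Transversality in homogeneous coordinates: [sum_l Lam U r (setf g (w l))] is the
   differential of [Lam U r] at [g] in the direction [w], as [Lam U r] does not depend
   on the factor [tag r]. *)
Definition regular (U : utilities) : Prop :=
  forall (T : forall i, {set option 'I_(n i).+1}) (Rs : {set edge}) (g : mixed),
    solvable_edges Rs -> (forall i, g i != 0) ->
    (forall i o, o \in T i -> hyp_form o (g i) = 0) ->
    (forall r, r \in Rs -> Lam U r g = 0) ->
    forall (y : forall i, option 'I_(n i).+1 -> R) (z : edge -> R),
    exists w : mixed,
      (forall i o, o \in T i -> hyp_form o (w i) = y i o) /\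
      (forall r, r \in Rs -> \sum_(l | l != tag r) Lam U r (setf g (w l)) = z r).

Section Dichotomy.
Variables (T : forall i, {set option 'I_(n i).+1}) (d : 'I_m -> nat).
Variables (B : forall l, 'M[R]_(d l, (n l).+1)).
Hypothesis BT : forall l w, (forall o, o \in T l -> hyp_form o w = 0) <->
  exists x, w = x *m B l.

(** The values of the hyperplane forms are attained first, by some [w0]; the freedom left is that of
    the directions in the spans of the [B l]. If these do not suffice, duality gives a relation [b],
    and restricting it to its support and rescaling brings it to the normalized form. *)
Lemma regular_or_degenerate (U : utilities) (Rs : {set edge}) (g : mixed) :
  (forall i, g i != 0) ->
  (forall i o, o \in T i -> hyp_form o (g i) = 0) ->
  (forall r, r \in Rs -> Lam U r g = 0) ->
  (forall (y : forall i, option 'I_(n i).+1 -> R) (z : edge -> R),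
    exists w : mixed,
      (forall i o, o \in T i -> hyp_form o (w i) = y i o) /\
      (forall r, r \in Rs -> \sum_(l | l != tag r) Lam U r (setf g (w l)) = z r)) \/
  (exists (Rs' : {set edge}) (r0 : edge) (c : {dffun forall l, 'I_(d l)}),
    [/\ Rs' \subset Rs, r0 \in Rs' & degenerate Rs' B c r0 U]).
Proof.
move=> g0 gT Lam0.
pose D := {l : 'I_m & 'I_(d l)}; pose K := {r : edge | r \in Rs}.
pose A (p : D) (k : K) : R := if tag p == tag (val k) then 0 else
  Lam U (val k) (setf g (row (tagged p) (B (tag p)))).
have [surj|[b [k0 bk0] Ab]] := surjective_or_dependent A; [left|right].
  move=> y z.
  have [w0 w0P] : {w0 : mixed | forall i o, o \in T i -> hyp_form o (w0 i) = y i o}.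
    apply: cid; exists (fun i => sval (cid (hyp_form_surjective (y i) (g0 i) (gT i)))).
    by move=> i; case: cid.
  have [u uP] := surj (fun k => z (val k) -
    \sum_(l | l != tag (val k)) Lam U (val k) (setf g (w0 l))).
  pose x l : 'rV[R]_(d l) := \row_j u (existT _ l j).
  exists (fun l => x l *m B l + w0 l); split=> [i o oT|r rRs].
    rewrite -[x i *m B i]scale1r hyp_form_linear w0P // mul1r.
    by rewrite ((BT (x i *m B i)).2 _ o oT) ?add0r //; exists (x i).
  have := uP (Sub r rRs); rewrite /= => /eqP; rewrite eq_sym subr_eq eq_sym => /eqP <-.
  have {uP} -> : \sum_d u d * A d (Sub r rRs) =
      \sum_(l | l != tag r) Lam U r (setf g (x l *m B l)).
    under [RHS]eq_bigr => l lr do rewrite Lam_mulmx //.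
    rewrite sig_big_dep /= [RHS]big_mkcond; apply: eq_bigr => -[l j] _ /=.
    by rewrite andbT mxE /A /=; case: eqP => _; rewrite ?mulr0.
  rewrite -big_split /=; apply: eq_bigr => l lr.
  by have := Lam_linear U g 1 (x l *m B l) (w0 l) lr; rewrite scale1r mul1r.
pose bb r := if insub r is Some k then b (k : K) else 0.
have bbE k : bb (val k) = b k by rewrite /bb valK.
pose Rs' := [set r in Rs | bb r != 0].
have Rs'Rs r : r \in Rs' -> r \in Rs by rewrite inE => /andP[].
pose r0 := val k0; have r0Rs' : r0 \in Rs' by rewrite inE bbE bk0 (valP k0).
have [x xB] : {x : forall l, 'rV[R]_(d l) | forall l, g l = x l *m B l}.
  by apply: cid; exists (fun l => sval (cid ((BT (g l)).1 (gT l)))) => l; case: cid.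
have [c cP] : {c : forall l, 'I_(d l) | forall l, x l 0 (c l) != 0}.
  have xP l : exists j, x l 0 j != 0.
    by apply/rV0Pn; apply: contraNneq (g0 l) => x0; rewrite xB x0 mul0mx.
  by apply: cid; exists (fun l => sval (cid (xP l))) => l; case: cid.
pose mu l := (x l 0 (c l))^-1; have mu0 l : mu l != 0 by rewrite invr_eq0 cP.
pose pm (r : edge) := \prod_(k | k != tag r) mu k.
have pm0 (r : edge) : pm r != 0 by apply/prodf_neq0 => k _; exact: mu0.
(* Rescaling each [g k] by [mu k] multiplies the derivative of [Lam U r] along the factor [l] by
   [pm r / mu l]; division by [pm r] leaves a factor independent of [r]. *)
pose beta r := bb r / pm r.
have beta0 r : r \in Rs' -> beta r != 0.
  by rewrite inE => /andP[_ br]; rewrite mulf_neq0 // invr_eq0.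
pose g' : mixed := fun l => (mu l *: x l) *m B l.
have g'E : g' = fun l => mu l *: g l.
  by apply: functional_extensionality_dep => l; rewrite /g' xB scalemxAl.
have Lam0' r : r \in Rs -> Lam U r g' = 0 by move=> rRs; rewrite g'E Lam_scale Lam0 ?mulr0.
exists Rs', r0, (finfun c); split => //.
  by apply/fintype.subsetP => r; exact: Rs'Rs.
exists (fun l => mu l *: x l), (fun r => beta r / beta r0); split.
- by move=> l; rewrite ffunE mxE mulVf.
- by rewrite divff // beta0.
- by move=> r rRs'; rewrite mulf_neq0 ?invr_eq0 ?beta0.
- by move=> r /Rs'Rs; exact: Lam0'.
move=> l j; rewrite -/g'.
have LamE r : r \in Rs -> Lam U r (setf g' (row j (B l))) =
    if l == tag r then 0 else pm r * (mu l)^-1 * Lam U r (setf g (row j (B l))).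
  move=> rRs; have [lr|lr] := eqVneq l (tag r).
    by rewrite -[RHS](Lam0' r rRs); apply: Lam_ext => k kr; rewrite setf_out // lr.
  have -> : setf g' (row j (B l)) = fun k => mu k *: setf g ((mu l)^-1 *: row j (B l)) k.
    apply: setf_eq => [|k kl]; first by rewrite setf_in scalerA divff ?scale1r.
    by rewrite setf_out // g'E.
  by rewrite Lam_scale Lam_setfZ // mulrA.
transitivity ((mu l)^-1 / beta r0 * \sum_(k : K) A (existT _ l j) k * b k); last first.
  by rewrite Ab mulr0.
rewrite (_ : \sum_(k : K) _ = \sum_(r in Rs) bb r *
    (if l == tag r then 0 else Lam U r (setf g (row j (B l))))); last first.
  by rewrite [RHS]big_sub; apply: eq_bigr => k _; rewrite bbE mulrC.
rewrite big_distrr /= [LHS]big_mkcond [RHS]big_mkcond; apply: eq_bigr => r _.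
rewrite inE; case rRs: (r \in Rs) => //=; have [->|br] := eqVneq (bb r) 0.
  by rewrite mul0r mulr0.
rewrite LamE //; case: eqP => _; first by rewrite !mulr0.
move: (beta r0) (beta0 r0 r0Rs') => B0 B00; rewrite /beta; field.
by rewrite mu0 B00 pm0.
Qed.
End Dichotomy.

(** There are finitely many choices of hyperplanes, edges and normalizations, and for each of them
    the degenerate utilities are thin. *)
Lemma exists_regular : exists2 Q : mpoly #|{: 'I_m * profile n}| R, Q != 0 &
  forall U : utilities, peval Q U != 0 -> regular U.
Proof.
have [dB dBP] : {dB : forall k, {set option 'I_k.+1} -> {d & 'M[R]_(d, k.+1)} |
    forall k (T : {set option 'I_k.+1}), row_free (tagged (dB k T)) /\
      forall w, (forall o, o \in T -> hyp_form o w = 0) <->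
        exists x, w = x *m tagged (dB k T)}.
  have H k (T : {set option 'I_k.+1}) : exists dB : {d & 'M[R]_(d, k.+1)},
      row_free (tagged dB) /\ forall w, (forall o, o \in T -> hyp_form o w = 0) <->
        exists x, w = x *m tagged dB.
    by have [d [B BP]] := hyp_kernel_basis R T; exists (existT _ d B).
  by apply: cid; exists (fun k T => sval (cid (H k T))) => k T; case: cid.
pose I := {dffun forall i, {set option 'I_(n i).+1}}.
pose d (T : I) l := tag (dB (n l) (T l)).
pose B (T : I) l : 'M[R]_(d T l, (n l).+1) := tagged (dB (n l) (T l)).
have [Q Q0 QP] : thin (\bigcup_(T : I) \bigcup_(Rs : {set edge}) \bigcup_(r0 : edge)
    \bigcup_(c : {dffun forall l, 'I_(d T l)})
    [set U | [/\ solvable_edges Rs, r0 \in Rs & degenerate Rs (B T) c r0 U]]).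
  apply: thin_bigcup => T; apply: thin_bigcup => Rs; apply: thin_bigcup => r0.
  apply: thin_bigcup => c.
  have [[solv r0Rs]|no] := pselect (solvable_edges Rs /\ r0 \in Rs); last first.
    by apply: thin_sub (@thin0 R _) => U [solv r0Rs _]; apply: no.
  apply: thin_sub (thin_degenerate (B := B T) c _ r0Rs _) => [U []//|l|i y].
    exact: (dBP _ _).1.
  exact: solv.
exists Q => // U QU T Rs g solv g0 gT Lam0 y z.
pose T' : I := [ffun i => T i].
have gT' i o : o \in T' i -> hyp_form o (g i) = 0 by rewrite ffunE; exact: gT.
have BT l w := (dBP _ (T' l)).2 w.
have [H|] := regular_or_degenerate (B := B T') BT g0 gT' Lam0.
- have [w [w1 w2]] := H y z; exists w; split=> // i o oT.
  by apply: w1; rewrite ffunE.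
case=> Rs' [r0 [c [Rs'Rs r0Rs' degU]]].
case/eqP: QU; apply: QP; exists T' => //; exists Rs' => //; exists r0 => //; exists c => //.
split => // i u; have [v vP] := solv i u; exists v => jk /(fintype.subsetP Rs'Rs).
exact: vP.
Qed.
End RegularUtilities.

(** * Smoothness of rational functions *)

Lemma near_eq_differentiable (R : numFieldType) (V W : normedModType R)
    (f g : V -> W) (x : V) :
  (\near x, f x = g x) -> differentiable f x -> differentiable g x.
Proof.
move=> fg fx.
have gE : g \o shift x = cst (g x) + 'd f x +o_ 0 id.
  apply/eqaddoP => eps eps0; have /eqaddoP/(_ eps eps0) := diff_locally fx.
  have fgx : f x = g x by exact: nbhs_singleton fg.
  move: fg; rewrite (near_shift 0) subr0 => fg fle.
  by near=> h; rewrite -fgx /= !fctE /= -(near fg h) //; near: h; exact: fle.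
have cd := diff_continuous fx.
by apply/diff_locallyP; rewrite (diff_unique cd gE).
Unshelve. all: by end_near. Qed.

Section RationalFunctions.
Variables (R : realType) (d : nat).
Implicit Types (O : set 'rV[R]_d) (f g : 'rV[R]_d -> R).

(** A class of expressions stable, on [O], under directional derivatives; smoothness of all orders
    follows by induction on the order. *)
Inductive rational_on O : ('rV[R]_d -> R) -> Prop :=
| rational_cst c : rational_on O (fun=> c)
| rational_coord j : rational_on O (fun x => x 0 j)
| rationalD f g : rational_on O f -> rational_on O g -> rational_on O (fun x => f x + g x)
| rationalM f g : rational_on O f -> rational_on O g -> rational_on O (fun x => f x * g x)
| rationalV f : rational_on O f -> (forall x, O x -> f x != 0) ->
    rational_on O (fun x => (f x)^-1).

Lemma eq_rational O f g : f =1 g -> rational_on O f -> rational_on O g.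
Proof. by move=> /funext ->. Qed.

Lemma rational_sum O (I : Type) (r : seq I) (P : pred I) (F : I -> 'rV[R]_d -> R) :
  (forall i, P i -> rational_on O (F i)) ->
  rational_on O (fun x => \sum_(i <- r | P i) F i x).
Proof.
move=> FP; elim: r => [|i r IH].
  by apply: (eq_rational _ (rational_cst O 0)) => x; rewrite big_nil.
case Pi : (P i); last by apply: (eq_rational _ IH) => x; rewrite big_cons Pi.
by apply: (eq_rational _ (rationalD (FP i Pi) IH)) => x; rewrite big_cons Pi.
Qed.

Lemma rational_prod O (I : Type) (r : seq I) (P : pred I) (F : I -> 'rV[R]_d -> R) :
  (forall i, P i -> rational_on O (F i)) ->
  rational_on O (fun x => \prod_(i <- r | P i) F i x).
Proof.
move=> FP; elim: r => [|i r IH].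
  by apply: (eq_rational _ (rational_cst O 1)) => x; rewrite big_nil.
case Pi : (P i); last by apply: (eq_rational _ IH) => x; rewrite big_cons Pi.
by apply: (eq_rational _ (rationalM (FP i Pi) IH)) => x; rewrite big_cons Pi.
Qed.

Lemma rational_subset O O' f : O' `<=` O -> rational_on O f -> rational_on O' f.
Proof.
move=> O'O; elim=> [c|j|? ? _ ? _ ?|? ? _ ? _ ?|g _ IH g0].
- exact: rational_cst.
- exact: rational_coord.
- exact: rationalD.
- exact: rationalM.
- by apply: rationalV => // x /O'O; exact: g0.
Qed.

Lemma rational_differentiable O f : rational_on O f ->
  forall x, O x -> differentiable f x.
Proof.
elim=> [c|j|{}f g _ IHf _ IHg|{}f g _ IHf _ IHg|{}f _ IHf f0] x Ox.
- exact: differentiable_cst.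
- exact: differentiable_coord.
- by apply: differentiableD; [exact: IHf|exact: IHg].
- by apply: differentiableM; [exact: IHf|exact: IHg].
- by apply: differentiableV; [exact: IHf|exact: f0].
Qed.

Lemma rational_derive O f v : rational_on O f ->
  exists2 g, rational_on O g & forall x, O x -> 'D_v f x = g x.
Proof.
elim=> [c|j|f1 f2 r1 [g1 rg1 E1] r2 [g2 rg2 E2]|f1 f2 r1 [g1 rg1 E1] r2 [g2 rg2 E2]|
        f1 r1 [g1 rg1 E1] f10].
- exists (fun=> 0) => [|x _]; first exact: rational_cst.
  exact: derive_cst.
- exists (fun=> v 0 j) => [|x _]; first exact: rational_cst.
  have := derive_mx (@derivable_id _ _ x v); rewrite derive_id.
  by move/matrixP/(_ 0 j); rewrite !mxE => ->.
- exists (fun x => g1 x + g2 x) => [|x Ox]; first exact: rationalD.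
  by rewrite deriveD ?E1 ?E2 //; apply: diff_derivable; apply: rational_differentiable Ox.
- exists (fun x => f1 x * g2 x + f2 x * g1 x) => [|x Ox].
    by apply: rationalD; exact: rationalM.
  by rewrite deriveM ?E1 ?E2 //; apply: diff_derivable; apply: rational_differentiable Ox.
exists (fun x => - 1 * ((f1 x)^-1 * (f1 x)^-1) * g1 x) => [|x Ox].
  by do ![apply: rationalM => //]; [exact: rational_cst|exact: rationalV|exact: rationalV].
rewrite deriveV ?f10 ?E1 //; last first.
  by apply: diff_derivable; apply: rational_differentiable Ox.
by rewrite mulN1r -expr2 exprVn.
Qed.

Lemma rational_open O f : open O -> rational_on O f -> open [set x | O x /\ f x != 0].
Proof.
move=> oO rf; rewrite openE => x [Ox fx0].
have Onear : \forall y \near x, O y by exact: open_nbhs_nbhs.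
have fcont : {for x, continuous f}.
  exact/differentiable_continuous/(rational_differentiable rf).
have f0 : \forall y \near x, f y != 0.
  exact: (@cvgr_neq0 R R _ (nbhs x) _ f (f x) fcont fx0).
by near=> y; split; [near: y|near: y].
Unshelve. all: by end_near. Qed.

(** The equality with a rational function is assumed on [O] only, because the derivatives ['D_v F],
    to which the induction applies, are known only there. *)
Lemma rational_smooth O f (F : 'rV[R]_d -> 'rV[R]_1) : open O -> rational_on O f ->
  (forall x, O x -> F x = f x *: const_mx 1) -> smooth_on O F.
Proof.
move=> oO rf FE k; elim: k f F rf FE => [|k IH] f F rf FE /=.
  move=> x Ox; apply: differentiable_continuous.
  apply: (@near_eq_differentiable _ _ _ (fun y => f y *: const_mx 1)).
    by near=> y; rewrite FE //; near: y; exact: open_nbhs_nbhs.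
  exact/differentiableZl/(rational_differentiable rf).
have Fdiff x : O x -> differentiable F x.
  move=> Ox; apply: (@near_eq_differentiable _ _ _ (fun y => f y *: const_mx 1)).
    by near=> y; rewrite FE //; near: y; exact: open_nbhs_nbhs.
  exact/differentiableZl/(rational_differentiable rf).
split=> [x v Ox|v]; first exact/diff_derivable/Fdiff.
have [g rg gE] := rational_derive v rf; apply: (IH g) => // x Ox.
have fx : differentiable f x by exact: (rational_differentiable rf).
rewrite (@near_eq_derive _ _ _ F (fun y => f y *: const_mx 1)); last first.
  by near=> y; rewrite FE //; near: y; exact: open_nbhs_nbhs.
rewrite deriveE; last exact: differentiableZl.
by rewrite diffZl // -deriveE // gE.
Unshelve. all: by end_near. Qed.

End RationalFunctions.

(** * Charts of the product of projective spaces *)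

Section Charts.
Variables (R : realType) (m : nat) (n : 'I_m -> nat).
Notation mixed := (mixed R n).
Notation mproj := (mproj R n).
Notation dim := (\sum_i n i)%N.
Notation psi := (@mproj_param R m n).
Notation chart := (forall i, 'I_(n i).+1).
Implicit Types (c : chart) (x v : 'rV[R]_dim) (g : mixed) (q : mproj).

Definition lift_of q g : Prop := forall l, val (q l) = <[g l]>%VS.

Definition hlift c x : mixed := fun l => homogenize (c l) (submxrow x l).

Definition normalize c g : mixed := fun l => (g l 0 (c l))^-1 *: g l.

Definition pick_lift q : mixed := fun l => vpick (val (q l)).

Definition chart_domain c : set mproj := [set q | forall l, pick_lift q l 0 (c l) != 0].

Lemma hlift_lift c x : lift_of (psi c x) (hlift c x). Proof. by []. Qed.

Lemma hliftE c x l j : hlift c x l 0 j =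
  if unlift (c l) j is Some j' then x 0 (tagnat.Rank l j') else 1.
Proof. by rewrite mxE; case: (unlift _ _) => // j'; rewrite mxE. Qed.

Lemma hlift_chart c x l : hlift c x l 0 (c l) = 1.
Proof. by rewrite hliftE unlift_none. Qed.

Lemma lift_neq0 q g : lift_of q g -> forall l, g l != 0.
Proof.
move=> qg l; have := eqP (valP (q l)); rewrite qg dim_vline.
by case: eqP.
Qed.

Lemma pick_liftP q : lift_of q (pick_lift q).
Proof.
move=> l; have L1 := eqP (valP (q l)).
apply/eqP; rewrite eq_sym eqEdim -memvE memv_pick L1 dim_vline vpick0.
by rewrite -dimv_eq0 L1.
Qed.

Lemma lift_scale q g h : lift_of q g -> lift_of q h ->
  exists mu : 'I_m -> R, (forall l, mu l != 0) /\ h = fun l => mu l *: g l.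
Proof.
move=> qg qh.
have [mu muP] : {mu : 'I_m -> R | forall l, h l = mu l *: g l}.
  have H l : exists k, h l = k *: g l by apply/vlineP; rewrite -qg qh memv_line.
  by apply: cid; exists (fun l => sval (cid (H l))) => l; case: cid.
exists mu; split; last exact: functional_extensionality_dep.
move=> l; apply: contraNneq (lift_neq0 qh l) => mu0.
by rewrite muP mu0 scale0r.
Qed.

Lemma chart_domainE c q g : lift_of q g ->
  chart_domain c q <-> forall l, g l 0 (c l) != 0.
Proof.
move=> qg; have [mu [mu0 E]] := lift_scale qg (pick_liftP q).
by split=> H l; have := H l; rewrite E !mxE mulf_eq0 negb_or (negbTE (mu0 l)) ?mu0 // => ->.
Qed.

Lemma normalize_lift c q g : lift_of q g -> normalize c (pick_lift q) = normalize c g.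
Proof.
move=> qg; have [mu [mu0 ->]] := lift_scale qg (pick_liftP q).
apply: functional_extensionality_dep => l; rewrite /normalize !mxE scalerA; congr (_ *: _).
by rewrite invfM mulrAC mulVf ?mul1r.
Qed.

Definition embed (l : 'I_m) (u : 'rV[R]_(n l)) : 'rV[R]_dim :=
  \mxrow_j (eqtype.dfwith (fun j => 0 : 'rV[R]_(n j)) u j).

(** The differential of [homogenize c]. *)
Definition lin k (c : 'I_k.+1) (u : 'rV[R]_k) : 'rV[R]_k.+1 :=
  \row_j (if unlift c j is Some j' then u 0 j' else 0).

Lemma embedE (l k : 'I_m) (u : 'rV[R]_(n l)) (j : 'I_(n k)) :
  embed u 0 (tagnat.Rank k j) = eqtype.dfwith (fun j => 0 : 'rV[R]_(n j)) u k 0 j.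
Proof.
have := mxrowK (eqtype.dfwith (fun j => 0 : 'rV[R]_(n j)) u) k.
by move/rowP/(_ j); rewrite mxE.
Qed.

Lemma hlift_embed c x l (u : 'rV[R]_(n l)) t :
  hlift c (t *: embed u + x) = setf (hlift c x) (hlift c x l + t *: lin (c l) u).
Proof.
apply/esym/setf_eq => [|k kl]; apply/rowP => j.
  rewrite [RHS]mxE [X in _ = _ + X]mxE [X in _ = _ + _ * X]mxE !hliftE.
  case: unliftP => [j' _|_]; last by rewrite mulr0 addr0.
  by rewrite [LHS]mxE [X in X + _]mxE embedE eqtype.dfwith_in addrC.
rewrite !hliftE; case: (unlift _ _) => // j'.
rewrite [LHS]mxE [X in X + _]mxE embedE eqtype.dfwith_out 1?eq_sym //.
by rewrite mxE mulr0 add0r.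
Qed.

(** The derivative of [mform tau] after normalization, at a normalized [g] and in the direction [w]
    of the factor [l]; by the quotient rule, the second term comes from keeping the coordinate [c l]
    equal to 1. *)
Definition normal_deriv (tau : profile n -> R) c l (w : 'rV[R]_(n l).+1) g : R :=
  mform tau (setf g w) - mform tau g * w 0 (c l).

Section LocalForm.
Variables (c0 c : chart).

Definition overlap : set 'rV[R]_dim := [set x | forall l, hlift c x l 0 (c0 l) != 0].

(** Equations are written in the chart [c0], but smoothness is tested in every chart [c]: this is
    the point with coordinates [x] in the chart [c], normalized for [c0]. *)
Definition rep x : mixed := normalize c0 (hlift c x).

Lemma overlapE x : chart_domain c0 (psi c x) <-> overlap x.
Proof. exact: chart_domainE (hlift_lift c x). Qed.

Lemma rational_hlift O l j : rational_on O (fun x => hlift c x l 0 j).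
Proof.
case E : (unlift (c l) j) => [j'|].
  by apply: (eq_rational _ (rational_coord _ (tagnat.Rank l j'))) => x; rewrite hliftE E.
by apply: (eq_rational _ (rational_cst _ 1)) => x; rewrite hliftE E.
Qed.

Lemma overlap_open : open overlap.
Proof.
rewrite (_ : overlap = [set x | setT x /\ \prod_l hlift c x l 0 (c0 l) != 0]).
  apply: rational_open; first exact: openT.
  by apply: rational_prod => l _; exact: rational_hlift.
apply/seteqP; split=> x /=; first by move=> xo; split=> //; apply/prodf_neq0 => l _; exact: xo.
by move=> [_ /prodf_neq0 xo] l; exact: xo.
Qed.

Lemma rational_rep l j : rational_on overlap (fun x => rep x l 0 j).
Proof.
apply: (@eq_rational _ _ _ (fun x => (hlift c x l 0 (c0 l))^-1 * hlift c x l 0 j)) => [x|].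
  by rewrite /rep /normalize [RHS]mxE.
apply: rationalM; last exact: rational_hlift.
by apply: rationalV => [|x xo]; [exact: rational_hlift|exact: xo].
Qed.

Lemma rational_mform O (g : 'rV[R]_dim -> mixed) tau :
  (forall l j, rational_on O (fun x => g x l 0 j)) -> rational_on O (fun x => mform tau (g x)).
Proof.
move=> gr; apply: rational_sum => s _; apply: rationalM; last exact: rational_cst.
by apply: rational_prod => k _; exact: gr.
Qed.

Lemma rational_normal_deriv tau l (w : 'rV[R]_(n l).+1) :
  rational_on overlap (fun x => normal_deriv tau c0 w (rep x)).
Proof.
apply: rationalD.
  apply: rational_mform => k j; have [E|kl] := eqVneq k l.
    rewrite {k}E in j *.
    by apply: (eq_rational _ (rational_cst _ (w 0 j))) => x; rewrite setf_in.
  apply: (@eq_rational _ _ _ (fun x => rep x k 0 j)) => [x|]; first by rewrite setf_out.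
  exact: rational_rep.
apply: (@eq_rational _ _ _ (fun x => -1 * (mform tau (rep x) * w 0 (c0 l)))) => [x|].
  by rewrite mulN1r.
apply: rationalM; first exact: rational_cst.
apply: rationalM; last exact: rational_cst.
exact/rational_mform/rational_rep.
Qed.

Lemma normal_deriv_linear tau l (a : R) (u v : 'rV[R]_(n l).+1) g :
  normal_deriv tau c0 (a *: u + v) g = a * normal_deriv tau c0 u g + normal_deriv tau c0 v g.
Proof. by rewrite /normal_deriv mform_linear !mxE; ring. Qed.

(** Only the factor [l] moves, and for small [t != 0] the difference quotient is exactly
    [N / (h + t * D)]. *)
Lemma derive_embed tau x l (u : 'rV[R]_(n l)) : overlap x ->
  'D_(embed u) (fun x => mform tau (rep x)) x =
    normal_deriv tau c0 (lin (c l) u) (rep x) / hlift c x l 0 (c0 l).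
Proof.
move=> xo; set h := hlift c x l 0 (c0 l); set D := lin (c l) u 0 (c0 l).
have h0 : h != 0 by exact: xo.
set N := normal_deriv _ _ _ _.
have hD : (fun t : R => h + t * D) @ (0 : R) --> h.
  rewrite -[X in _ --> X]addr0 -[X in _ --> _ + X](mul0r D).
  by apply: cvgD; [exact: cvg_cst|apply: cvgM; [exact: cvg_id|exact: cvg_cst]].
have hD0 : \forall t \near (0 : R), h + t * D != 0.
  exact: (@cvgr_neq0 R R _ (nbhs (0 : R)) _ (fun t => h + t * D) h hD h0).
rewrite /derive; apply: cvg_lim => //.
have lim : (fun t : R => N / (h + t * D)) @ (0 : R)^' --> N / h.
  apply: cvg_within_filter; apply: cvgM; first exact: cvg_cst.
  exact: cvgV.
apply: cvg_trans lim; apply: near_eq_cvg.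
have repE t : h + t * D != 0 -> rep (t *: embed u + x) =
    setf (rep x) ((h + t * D)^-1 *: (h *: rep x l + t *: lin (c l) u)).
  move=> htD; rewrite /rep hlift_embed; apply/esym/setf_eq => [|k kl].
    rewrite /normalize setf_in [X in X^-1]mxE [X in (_ + X)^-1]mxE -/h -/D.
    by rewrite scalerA divff // scale1r.
  by rewrite /normalize setf_out.
near=> t.
have t0 : t != 0 by near: t; exact: nbhs_dnbhs_neq.
have htD : h + t * D != 0 by near: t; exact: nbhs_dnbhs hD0.
rewrite /= repE // mform_setfZ mform_linear setf_id mform_setfZ.
rewrite /N /normal_deriv -/D /GRing.scale /=; field.
by rewrite t0 htD.
Unshelve. all: by end_near. Qed.

(** The vectors [lin (c l) u] are those with coordinate [c l] equal to 0. Modulo the radial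
    direction [hlift c x l], on which [normal_deriv] vanishes by homogeneity, every [w] is of this
    kind. *)
Lemma lin_onto x l (w : 'rV[R]_(n l).+1) : overlap x -> exists u : 'rV[R]_(n l),
  forall tau, normal_deriv tau c0 (lin (c l) u) (rep x) = normal_deriv tau c0 w (rep x).
Proof.
move=> xo; set h := hlift c x l; set e := w - w 0 (c l) *: h.
exists (\row_j e 0 (lift (c l) j)) => tau.
have -> : lin (c l) (\row_j e 0 (lift (c l) j)) = - w 0 (c l) *: h + w.
  apply/rowP => j; rewrite mxE; case: unliftP => [j' ->|->].
    by rewrite !mxE; ring.
  by rewrite [RHS]mxE [X in X + _]mxE hlift_chart mulr1 addNr.
have h0 : h 0 (c0 l) != 0 by exact: xo.
rewrite normal_deriv_linear (_ : normal_deriv tau c0 h (rep x) = 0) ?mulr0 ?add0r //.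
have hE : h = h 0 (c0 l) *: rep x l by rewrite /rep /normalize scalerA divff // scale1r.
have repc : rep x l 0 (c0 l) = 1 by rewrite /rep /normalize mxE mulVf.
by rewrite /normal_deriv hE mform_setfZ setf_id [X in _ - _ * X]mxE repc mulr1 mulrC subrr.
Qed.

End LocalForm.
End Charts.

(** * Transversality of hypersurfaces given locally by multilinear forms *)

Section LocalTransversality.
Variables (R : realType) (m : nat) (n : 'I_m -> nat).
Notation mixed := (mixed R n).
Notation mproj := (mproj R n).
Notation dim := (\sum_i n i)%N.
Notation psi := (@mproj_param R m n).
Notation chart := (forall i, 'I_(n i).+1).

Definition local_lift (c0 : chart) (q : mproj) : mixed := normalize c0 (pick_lift q).

Lemma local_lift_param (c0 c : chart) x : local_lift c0 (psi c x) = rep c0 c x.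
Proof. exact: normalize_lift (hlift_lift c x). Qed.

Definition local_map (c0 : chart) (tau : profile n -> R) (q : mproj) : 'rV[R]_1 :=
  mform tau (local_lift c0 q) *: const_mx 1.

Lemma local_map_param (c0 c : chart) tau :
  local_map c0 tau \o psi c = fun x => mform tau (rep c0 c x) *: const_mx 1.
Proof. by apply/funext => x; rewrite /= /local_map local_lift_param. Qed.

Lemma row1E (y : 'rV[R]_1) : y 0 0 *: const_mx 1 = y.
Proof. by apply/rowP => j; rewrite ord1 !mxE mulr1. Qed.

Lemma diff_local_map (c0 c : chart) tau x v : overlap c0 c x ->
  'd (local_map c0 tau \o psi c) x v =
    'd (fun x => mform tau (rep c0 c x)) x v *: const_mx 1.
Proof.
move=> xo; rewrite local_map_param diffZl //.
exact: (rational_differentiable (rational_mform _ (@rational_rep _ _ _ c0 c))).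
Qed.

Lemma diff_embed (c0 c : chart) tau x l (u : 'rV[R]_(n l)) : overlap c0 c x ->
  'd (fun x => mform tau (rep c0 c x)) x (embed u) =
    normal_deriv tau c0 (lin (c l) u) (rep c0 c x) / hlift c x l 0 (c0 l).
Proof.
move=> xo; rewrite -derive_embed // deriveE //.
exact: (rational_differentiable (rational_mform _ (@rational_rep _ _ _ c0 c))).
Qed.

(** A defining map must have surjective differential on all of [O], whereas joint surjectivity is
    required at [p] only. Hence a direction [N k] transversal to each member through [p] is fixed,
    and [O] consists of the points of the chart where all these directions remain transversal. *)
Lemma local_transversality (hm : (0 < m)%N) (K : finType) (P : set K)
    (H : K -> set mproj) (tau : K -> profile n -> R) (p : mproj) (c0 : chart) :
  chart_domain c0 p ->
  (forall k, P k -> H k p -> forall q, chart_domain c0 q ->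
     H k q <-> mform (tau k) (local_lift c0 q) = 0) ->
  (forall y : K -> R, exists w : mixed, forall k, P k -> H k p ->
     \sum_l mform (tau k) (setf (local_lift c0 p) (w l)) = y k) ->
  exists (O : set mproj) (F : K -> mproj -> 'rV[R]_1),
    (forall k, P k -> H k p -> defining_map psi (H k) p O (F k)) /\
    (forall c x, psi c x = p -> forall y : K -> 'rV[R]_1, exists v,
       forall k, P k -> H k p -> 'd (F k \o psi c) x v = y k).
Proof.
move=> pc0 HE surj; set G := local_lift c0 p in surj.
pose rel k := `[< P k /\ H k p >].
have tauG k : rel k -> mform (tau k) G = 0.
  by case/asboolP => Pk Hk; apply/(HE k Pk Hk).
have G1 l : G l 0 (c0 l) = 1 by rewrite /G /local_lift /normalize mxE mulVf.
have [N NP] : {N : K -> {l : 'I_m & 'rV[R]_(n l).+1} |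
    forall k, rel k -> normal_deriv (tau k) c0 (tagged (N k)) G != 0}.
  have NP k : exists lw : {l : 'I_m & 'rV[R]_(n l).+1},
      rel k -> normal_deriv (tau k) c0 (tagged lw) G != 0.
    case: (boolP (rel k)) => [relk|_]; last first.
      by exists (existT _ (Ordinal hm) (const_mx 0)).
    have [w wP] := surj (fun=> 1); case/asboolP: (relk) => Pk Hk.
    have [l wl] : exists l, mform (tau k) (setf G (w l)) != 0.
      apply/existsP; apply: contraT => /existsPn w0.
      have := wP k Pk Hk; rewrite big1 => [/eqP|l _]; first by rewrite eq_sym oner_eq0.
      by apply/eqP; rewrite -[_ == _]negbK w0.
    exists (existT _ l (w l)) => _.
    by rewrite /normal_deriv tauG // mul0r subr0.
  by apply: cid; exists (fun k => sval (cid (NP k))) => k; case: cid.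
pose ND k g := normal_deriv (tau k) c0 (tagged (N k)) g.
pose O : set mproj := [set q | chart_domain c0 q /\
  forall k, rel k -> ND k (local_lift c0 q) != 0].
pose D c : set 'rV[R]_dim := [set x | overlap c0 c x /\
  \prod_k (if rel k then ND k (rep c0 c x) else 1) != 0].
have OD c : psi c @^-1` O = D c.
  apply/seteqP; split=> x.
    move=> [/overlapE xo Ox]; split=> //; apply/prodf_neq0 => k _.
    by case: ifP => // /Ox; rewrite local_lift_param.
  move=> [xo /prodf_neq0 Dx]; split; first exact/overlapE.
  by move=> k relk; have := Dx k isT; rewrite relk local_lift_param.
have D_open c : open (D c).
  apply: rational_open; first exact: overlap_open.
  apply: rational_prod => k _; case: (rel k); last exact: rational_cst.
  exact: rational_normal_deriv.
have Op : O p by split=> // k; exact: NP.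
exists O, (fun k => local_map c0 (tau k)); split=> [k Pk Hk|c x xp y].
  have relk : rel k by apply/asboolP.
  split => //.
  - by move=> c; rewrite OD.
  - move=> c; rewrite OD; apply: (@rational_smooth _ _ _ (fun x => mform (tau k) (rep c0 c x))).
    + exact: D_open.
    + by apply: (@rational_subset _ _ (overlap c0 c)) => [x []//|];
         exact/rational_mform/rational_rep.
    + by move=> x _; rewrite local_map_param.
  - move=> q Oq c x xq y.
    have [xo _] : D c x by rewrite -OD /= xq.
    have [u uN] := lin_onto (tagged (N k)) xo.
    set l := tag (N k) in u uN *.
    have N0 : ND k (rep c0 c x) != 0.
      by rewrite -local_lift_param xq; apply: Oq.2.
    have h0 : hlift c x l 0 (c0 l) != 0 by exact: xo.
    exists ((y 0 0 * hlift c x l 0 (c0 l) / ND k (rep c0 c x)) *: embed u).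
    rewrite diff_local_map // linearZ /= diff_embed // uN -/(ND k _) -[RHS]row1E.
    congr (_ *: _); rewrite /GRing.scale /=; field.
    by rewrite h0 N0.
  - have Fp : local_map c0 (tau k) p = 0 by rewrite /local_map tauG ?scale0r.
    rewrite setIC; apply/seteqP; split=> q [Oq] /=; rewrite Fp => Hq; split=> //.
      by rewrite /local_map (HE k Pk Hk q Oq.1).1 ?scale0r.
    apply/(HE k Pk Hk q Oq.1); move/rowP: Hq => /(_ 0).
    by rewrite !mxE mulr1.
have xo : overlap c0 c x by apply/overlapE; rewrite xp.
have repG : rep c0 c x = G by rewrite -local_lift_param xp.
have [w wP] := surj (fun k => y k 0 0).
have [u uP] : {u : forall l, 'rV[R]_(n l) | forall l tau,
    normal_deriv tau c0 (lin (c l) (u l)) G = normal_deriv tau c0 (w l) G}.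
  have H1 l := lin_onto (w l) xo.
  by apply: cid; exists (fun l => sval (cid (H1 l))) => l; case: cid => ? /=; rewrite repG.
exists (\sum_l hlift c x l 0 (c0 l) *: embed (u l)) => k Pk Hk.
rewrite diff_local_map // linear_sum -[RHS]row1E; congr (_ *: _).
rewrite -(wP k Pk Hk); apply: eq_bigr => l _.
have h0 : hlift c x l 0 (c0 l) != 0 by exact: xo.
rewrite linearZ /= diff_embed // repG uP /GRing.scale /= mulrCA divff // mulr1.
rewrite /normal_deriv tauG ?mul0r ?subr0 //.
exact/asboolP.
Qed.

End LocalTransversality.

(** * Zariski closures *)

Section Lines.
Variable R : realType.

Notation line_fun := (@polyfun R unit).

Lemma line_fun_poly (f : (unit -> R) -> R) : line_fun f ->
  exists p : {poly R}, forall t, f t = p.[t tt].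
Proof.
move=> [P fP].
exists (\sum_(m <- msupp P) (mcoeff m P)%:P * \prod_i \prod_(j < m i) 'X) => t.
rewrite fP /peval mevalE horner_sum; apply: eq_bigr => m _.
rewrite hornerM hornerC horner_prod; congr (_ * _); apply: eq_bigr => i _.
rewrite horner_prod; under eq_bigr do rewrite hornerX.
by rewrite prodr_const card_ord; case: (enum_val i).
Qed.

Lemma poly_eq0_everywhere (p : {poly R}) : (forall t, p.[t] = 0) -> p = 0.
Proof.
move=> p0; apply: (@roots_geq_poly_eq0 _ _ [seq i%:R | i <- iota 0 (size p)]).
- by apply/allP => x _; rewrite /root p0.
- by rewrite map_inj_uniq ?iota_uniq //; exact: (mulrIn (oner_neq0 R)).
- by rewrite size_map size_iota.
Qed.

Lemma line_fun_prod_neq0 (I : finType) (z : I -> (unit -> R) -> R) :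
  (forall i, line_fun (z i)) -> (forall i, exists t, z i t != 0) ->
  exists t, \prod_i z i t != 0.
Proof.
move=> /(fun zP i => line_fun_poly (zP i))/choice[p pE] z0.
have /eqP p0 : \prod_i p i != 0.
  apply/prodf_neq0 => i _; have [t] := z0 i; apply: contraNneq => pi0.
  by rewrite pE pi0 horner0.
have [t pt] : exists t, (\prod_i p i).[t] != 0.
  apply: contrapT => /forallNP H; apply: p0; apply: poly_eq0_everywhere => t.
  by apply/eqP; rewrite -[_ == _]negbK; apply/negP/H.
exists (fun=> t); move: pt; rewrite horner_prod.
by under [X in _ -> X != 0]eq_bigr do rewrite pE.
Qed.

(** The identity principle in one variable. It takes the place of limits in the computation of
    Zariski closures: a point at infinity is put on a polynomial curve that lies in the affine part
    for almost all parameters. *)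
Lemma line_fun_vanish (f z : (unit -> R) -> R) : line_fun f -> line_fun z ->
  (exists t, z t != 0) -> (forall t, z t != 0 -> f t = 0) -> forall t, f t = 0.
Proof.
move=> fP zP z0 zf t; apply: contrapT => /eqP ft.
have [] := @line_fun_prod_neq0 bool (fun b => if b then f else z).
- by case.
- by case=> //; exists t.
by move=> u; rewrite big_bool /=; have [->|/zf ->] := eqVneq (z u) 0; rewrite ?mulr0 ?mul0r eqxx.
Qed.

End Lines.

Section Hyperplanes.
Variables (R : realType) (m : nat) (n : 'I_m -> nat).
Notation mproj := (mproj R n).

Lemma line_scale (k : nat) (L : Defs.proj R k) (v w : 'rV[R]_k.+1) :
  val L = <[v]>%VS -> val L = <[w]>%VS -> exists2 a, a != 0 & w = a *: v.
Proof.
move=> Lv Lw; have /vlineP[a wa] : w \in <[v]>%VS by rewrite -Lv Lw memv_line.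
exists a => //; apply/eqP => a0; have := eqP (valP L).
by rewrite Lw wa a0 scale0r dim_vline eqxx.
Qed.

Definition line_of (k : nat) (v : 'rV[R]_k.+1) (v0 : v != 0) : Defs.proj R k.
Proof. by exists <[v]>%VS; rewrite dim_vline v0. Defined.

Lemma scale_line (k : nat) (v : 'rV[R]_k.+1) a : a != 0 -> <[a *: v]>%VS = <[v]>%VS.
Proof.
move=> a0; apply/eqP; rewrite eqEsubv -!memvE memvZ ?memv_line //=.
by apply/vlineP; exists a^-1; rewrite scalerA mulVf ?scale1r.
Qed.

(** A point of the hyperplane lies on a line [w + t * e] inside it. Along this line the coordinate
    sum grows with [t], so all but one parameter give points of the affine part, and equations valid
    there hold at [w]. The direction [e] is a vertex other than [j], which exists as [0 < n i]. *)
Lemma H_coordE (hn : forall i, (0 < n i)%N) i (j : 'I_(n i).+1) (p : mproj) v :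
  val (p i) = <[v]>%VS -> H_coord j p <-> v 0 j = 0.
Proof.
move=> pv; pose X : mpoly (n i).+1 R := mpolyX R (mnm1 j); split=> [Hp|vj].
  have /(_ X erefl v pv) : [set L | forall P, P = X -> vanishes_on_line P L] (p i).
    apply: Hp; split.
      by exists [set X] => // P ->; exists 1%N; rewrite dhomogX; apply/eqP; exact: mdeg1.
    move=> L [w [_ wj Lw]] P -> u Lu; rewrite mevalXU.
    by have [a _ ->] := line_scale Lw Lu; rewrite mxE wj mulr0.
  by rewrite mevalXU.
move=> M [[E Ehom ->] GM] P EP w pw.
have wj : w 0 j = 0 by have [a _ ->] := line_scale pv pw; rewrite mxE vj mulr0.
have [j' j'j] : exists j', j' != j.
  have [->|j0] := eqVneq j ord0; last by exists ord0; rewrite eq_sym.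
  by exists (lift ord0 (Ordinal (hn i))); rewrite eq_sym neq_lift.
pose e : 'rV[R]_(n i).+1 := delta_mx 0 j'.
pose q (t : unit -> R) := w + t tt *: e.
have qE a t : q t 0 a = w 0 a + t tt * e 0 a by rewrite !mxE.
have qP a : polyfun (fun t => q t 0 a).
  apply: (polyfun_ext (fun t => esym (qE a t))); apply: polyfunD; first exact: polyfun_const.
  by apply: polyfunM; [exact: polyfun_var|exact: polyfun_const].
have sum_q t : \sum_a q t 0 a = \sum_a w 0 a + t tt.
  rewrite (eq_bigr _ (fun a _ => qE a t)) big_split /= -mulr_sumr; congr (_ + _).
  by rewrite (bigD1 j') //= mxE !eqxx big1 ?addr0 ?mulr1 // => a /negbTE aj; rewrite mxE aj andbF.
suff qt0 t : meval (q t 0) P = 0 by have := qt0 (fun=> 0); rewrite /q scale0r addr0.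
move: t; apply: (@line_fun_vanish R _ (fun t => \sum_a q t 0 a)).
- exact: polyfun_meval.
- exact: polyfun_sum.
- by exists (fun=> 1 - \sum_a w 0 a); rewrite sum_q addrC subrK oner_neq0.
move=> t; set z := \sum_a q t 0 a => z0.
have qz0 : z^-1 *: q t != 0.
  rewrite scaler_eq0 negb_or invr_eq0 z0; apply: contraNneq z0 => qt0.
  by rewrite /z qt0 big1 // => a _; rewrite mxE.
apply: (GM (line_of qz0) _ P EP) => /=; last by rewrite scale_line // invr_eq0.
exists (z^-1 *: q t); split=> //.
  rewrite /in_Ai; under eq_bigr do rewrite mxE.
  by rewrite -mulr_sumr mulVf.
by rewrite mxE qE wj mxE eq_sym (negbTE j'j) andbF !(mulr0, addr0).
Qed.

Lemma H_infE i (p : mproj) v :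
  val (p i) = <[v]>%VS -> H_inf i p <-> \sum_j v 0 j = 0.
Proof.
move=> pv; split=> [Hp|v0 [w wA pw]].
  apply: contrapT => /eqP v0; apply: Hp; exists ((\sum_j v 0 j)^-1 *: v).
    by rewrite /in_Ai; under eq_bigr do rewrite mxE; rewrite -mulr_sumr mulVf.
  by rewrite scale_line // invr_eq0.
have [a _ wE] := line_scale pv pw; move: wA; rewrite /in_Ai wE.
under eq_bigr do rewrite mxE.
by rewrite -mulr_sumr v0 mulr0 => /eqP; rewrite eq_sym oner_eq0.
Qed.

Lemma H_hypE (hn : forall i, (0 < n i)%N) i (o : option 'I_(n i).+1) (p : mproj) v :
  val (p i) = <[v]>%VS -> H_hyp o p <-> hyp_form o v = 0.
Proof. by case: o => [j|]; [exact: H_coordE|exact: H_infE]. Qed.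

End Hyperplanes.

(** * Zariski closures of the difference loci *)

Section DifferenceHypersurfaces.
Variables (R : realType) (m : nat) (n : 'I_m -> nat).
Notation mixed := (mixed R n).
Notation mproj := (mproj R n).
Notation utilities := (utilities R n).

Definition coords (g : mixed) (l : 'I_(mvars n)) : R :=
  g (tagnat.sig1 l) 0 (tagnat.sig2 l).

Lemma mform_mpoly (tau : profile n -> R) : exists2 P : mpoly (mvars n) R,
  multihomogeneous (fun=> 1%N) P & forall g, meval (coords g) P = mform tau g.
Proof.
pose mon (s : profile n) : multinom (mvars n) :=
  Multinom [tuple ((s (tagnat.sig1 x) == tagnat.sig2 x) : nat) | x < mvars n].
exists (\sum_s tau s *: mpolyX R (mon s)).
  move=> mm mmP i.
  have [s ->] : exists s, mm = mon s.
    apply: contrapT => /forallNP H; move: mmP; rewrite mcoeff_msupp raddf_sum /=.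
    rewrite big1 ?eqxx // => s _; rewrite mcoeffZ mcoeffX.
    by case: eqP => [/esym/H//|_]; rewrite mulr0.
  under eq_bigr do rewrite mnmE.
  rewrite big_mkcond.
  transitivity (\sum_k \sum_(j < (n k).+1) if k == i then (s k == j : nat) else 0)%N.
    by rewrite sig_big_dep /= (reindex _ tagnat.sig_bij_on).
  rewrite (bigD1 i) //= [X in (_ + X)%N]big1 ?addn0 => [|k ki]; last by rewrite (negbTE ki) big1.
  rewrite eqxx (bigD1 (s i)) //= eqxx big1 // => j js.
  by rewrite eq_sym (negbTE js).
move=> g; rewrite raddf_sum /=; apply: eq_bigr => s _.
rewrite mevalZ mulrC; congr (_ * _); rewrite mevalX; symmetry.
transitivity (\prod_k \prod_(j < (n k).+1) g k 0 j ^+ (s k == j)).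
  apply: eq_bigr => k _; rewrite (bigD1 (s k)) //= eqxx expr1 big1 ?mulr1 // => j js.
  by rewrite eq_sym (negbTE js) expr0.
rewrite sig_big_dep /= (reindex _ tagnat.sig_bij_on) /=.
by apply: eq_bigr => x _; rewrite mnmE.
Qed.

Lemma solvable_edges1 i (j k : 'I_(n i).+1) : j != k ->
  solvable_edges R [set existT _ i (j, k)].
Proof.
move=> jk i' y; have [E|ii'] := eqVneq i' i; last first.
  exists (fun=> 0) => a; rewrite inE => /eqP/(congr1 (@tag _ _)) /= ii.
  by rewrite ii eqxx in ii'.
move: y; rewrite E => y; exists (fun x => if x == j then y (j, k) else 0) => a.
rewrite inE -tag_eqE /tag_eq /= eqxx /= tagged_asE => /eqP ->.
by rewrite /= eqxx eq_sym (negbTE jk) subr0.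
Qed.

(** The products of [Lam U r] with the coordinates of [g i] are equations of the closure, and one of
    these coordinates is nonzero. Conversely, regularity at a zero of [Lam U r] yields a direction
    with nonzero derivative, by which a curve leaving infinity is pushed back into the zero set. *)
Lemma H_diffE (U : utilities) i (j k : 'I_(n i).+1) (p : mproj) g :
  regular U -> j != k -> lift_of p g ->
  H_diff U j k p <-> Lam U (existT _ i (j, k)) g = 0.
Proof.
move=> regU jk pg; set r : edge n := existT _ i (j, k); split=> [Hp|Lam0].
  have [P PP] : {P : 'I_(n i).+1 -> mpoly (mvars n) R | forall a,
      multihomogeneous (fun=> 1%N) (P a) /\
      forall g, meval (coords g) (P a) = g i 0 a * Lam U r g}.
    have H a : exists P : mpoly (mvars n) R, multihomogeneous (fun=> 1%N) P /\
        forall g, meval (coords g) P = g i 0 a * Lam U r g.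
      have [P P1 P2] := mform_mpoly (fun s => (s (tag r) == a)%:R * lam_tensor U r s).
      by exists P; split=> // h; rewrite P2 Lam_coord.
    by apply: cid; exists (fun a => sval (cid (H a))) => a; case: cid.
  have vanish : [set q | forall Q, range P Q -> mvanishes_on_lines Q q] p.
    apply: Hp; split.
      by exists (range P) => // _ [a _ <-]; exists (fun=> 1%N); exact: (PP a).1.
    move=> q [h [hA hdiff qh]] _ [a _ <-] h' qh'.
    apply: (etrans ((PP a).2 h')); have [mu [_ ->]] := lift_scale qh qh'.
    by rewrite Lam_scale -lambdaB hdiff !mulr0.
  have /rV0Pn[a ga] := lift_neq0 pg i.
  have := vanish (P a) (ex_intro2 _ _ a I erefl) g pg.
  by move/(etrans (esym ((PP a).2 g)))/eqP; rewrite mulf_eq0 (negbTE ga) => /eqP.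
move=> M [[E Ehom ->] GM] P EP h ph.
have {}Lam0 : Lam U r h = 0.
  by have [mu [_ ->]] := lift_scale pg ph; rewrite Lam_scale Lam0 mulr0.
have h0 := lift_neq0 ph.
pose sig l (w : 'rV[R]_(n l).+1) : R := \sum_a w 0 a.
have sigZ l a (u v : 'rV[R]_(n l).+1) : sig l (a *: u + v) = a * sig l u + sig l v.
  exact: (hyp_form_linear None).
have sigS l a (u : 'rV[R]_(n l).+1) : sig l (a *: u) = a * sig l u.
  by rewrite /sig mulr_sumr; apply: eq_bigr => x _; rewrite mxE.
(* The hyperplane at infinity is imposed exactly on the factors where [h] lies on it. There [W] lies
   at infinity too, so the correction by [W] does not affect the coordinate sum. *)
pose T l : {set option 'I_(n l).+1} := finset.finset (fun o => (o == None) && (sig l (h l) == 0)).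
have hT l o : o \in T l -> hyp_form o (h l) = 0.
  by rewrite inE => /andP[/eqP -> /eqP].
have hr r' : r' \in [set r]%SET -> Lam U r' h = 0 by move=> /set1P ->.
have [w [wT wLam]] := regU T _ h (solvable_edges1 jk) h0 hT hr (fun l o => 0) (fun=> 1).
have [l0 l0i Ww] : exists2 l0, l0 != i & Lam U r (setf h (w l0)) != 0.
  apply: contrapT => H; have := wLam r (set11 r); rewrite big1 => [/eqP|l li].
    by rewrite eq_sym oner_eq0.
  by apply: contrapT => /eqP Hl; apply: H; exists l.
set W := w l0 in Ww.
have sigW : sig l0 (h l0) = 0 -> sig l0 W = 0.
  by move=> s0; apply: (wT l0 None); rewrite inE s0 !eqxx.
pose e l : 'rV[R]_(n l).+1 := delta_mx 0 ord0.
have sige l : sig l (e l) = 1.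
  rewrite /sig (bigD1 ord0) //= mxE !eqxx big1 ?addr0 // => a /negbTE a0.
  by rewrite mxE a0 andbF.
pose gt (t : unit -> R) : mixed := fun l => t tt *: e l + h l.
(* [ct] is a curve through [h] in the cone [Lam U r = 0]; a multiple of [W] corrects the
   component [l0], and for almost all [t] no component lies at infinity. *)
pose A t := Lam U r (gt t); pose B t := Lam U r (setf (gt t) W).
set B0 := Lam U r (setf h W) in Ww.
pose ct (t : unit -> R) : mixed := setf (gt t) ((B t / B0) *: gt t l0 + (- A t / B0) *: W).
have gt0 : gt (fun=> 0) = h.
  by apply: functional_extensionality_dep => l; rewrite /gt scale0r add0r.
have A0 : A (fun=> 0) = 0 by rewrite /A gt0.
have ct0 : ct (fun=> 0) = h.
  rewrite /ct A0 oppr0 mul0r scale0r addr0 /B gt0 divff // scale1r.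
  exact: setf_id.
have gtP : polyfun_mixed gt.
  move=> l a; apply: (@polyfun_ext _ _ (fun t => t tt * e l 0 a + h l 0 a)) => [t|].
    by rewrite !mxE.
  apply: polyfunD; last exact: polyfun_const.
  by apply: polyfunM; [exact: polyfun_var|exact: polyfun_const].
have AP : polyfun A by exact: polyfun_Lam.
have BP : polyfun B by exact/polyfun_Lam/polyfun_setf.
have ctP : polyfun_mixed ct.
  move=> l a; have [E1|ll0] := eqVneq l l0.
    rewrite {l}E1 in a *.
    apply: (@polyfun_ext _ _ (fun t => (B t * B0^-1) * gt t l0 0 a + (-1 * A t * B0^-1) * W 0 a)).
      by move=> t; rewrite /ct setf_in [RHS]mxE [X in _ = X + _]mxE [X in _ = _ + X]mxE mulN1r.
    apply: polyfunD; repeat (apply: polyfunM || exact: polyfun_const || exact: gtP || by []).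
  by apply: (@polyfun_ext _ _ (fun t => gt t l 0 a)) => // t; rewrite /ct setf_out.
have ct_Lam t : Lam U r (ct t) = 0.
  have lr : l0 != tag r by [].
  rewrite /ct Lam_linear // setf_id Lam_setfZ // -/(A t) -/(B t).
  by ring.
have sigP l : polyfun (fun t => sig l (ct t l)) by apply: polyfun_sum.
have sig_neq0 l : exists t, sig l (ct t l) != 0.
  have [->|ll0] := eqVneq l l0; last first.
    exists (fun=> 1 - sig l (h l)); rewrite /ct setf_out // sigZ sige mulr1 subrK.
    exact: oner_neq0.
  have [s0|s0] := eqVneq (sig l0 (h l0)) 0; last by exists (fun=> 0); rewrite ct0.
  have [||t] := @line_fun_prod_neq0 R bool (fun b t => if b then B t else t tt).
  - by case; [exact: BP|exact: polyfun_var].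
  - case; last by exists (fun=> 1); rewrite oner_neq0.
    by exists (fun=> 0); rewrite /B gt0.
  rewrite big_bool /= => Bt; exists t; rewrite /ct setf_in sigZ sigS sigW // sigZ sige s0.
  by rewrite mulr0 !addr0 mulr1 mulrAC mulf_neq0 // invr_eq0.
suff fP t : meval (coords (ct t)) P = 0 by have := fP (fun=> 0); rewrite ct0.
move: t; apply: (line_fun_vanish _ _ (line_fun_prod_neq0 sigP sig_neq0)).
- by apply: polyfun_meval => a; exact: ctP.
- by apply: polyfun_prod.
move=> t /prodf_neq0 sig0.
have nz l : (sig l (ct t l))^-1 *: ct t l != 0.
  rewrite scaler_eq0 negb_or invr_eq0 sig0 //; apply: contraNneq (sig0 l isT) => ->.
  by rewrite /sig big1 // => a _; rewrite mxE.
pose q : mproj := fun l => line_of (nz l).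
have qct : lift_of q (ct t) by move=> l; rewrite /= scale_line // invr_eq0 sig0.
apply: (GM q _ P EP) => //; exists (fun l => (sig l (ct t l))^-1 *: ct t l); split=> //.
  move=> l; rewrite /in_Ai; under eq_bigr do rewrite mxE.
  by rewrite -mulr_sumr mulVf // sig0.
by rewrite lambdaB Lam_scale ct_Lam mulr0.
Qed.

End DifferenceHypersurfaces.

(** * The families of hypersurfaces *)

Section Families.
Variables (R : realType) (m : nat) (n : 'I_m -> nat).
Hypotheses (hm : (0 < m)%N) (hn : forall i, (0 < n i)%N).
Notation mixed := (mixed R n).
Notation mproj := (mproj R n).
Notation utilities := (utilities R n).
Notation chart := (forall i, 'I_(n i).+1).

Lemma exists_chart (p : mproj) : exists c0 : chart, chart_domain c0 p.
Proof.
have [c [x <-]] := mproj_param_cover p; exists c.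
by apply/(chart_domainE c (hlift_lift c x)) => l; rewrite hlift_chart oner_neq0.
Qed.

Lemma local_lift_lift (c0 : chart) (q : mproj) :
  chart_domain c0 q -> lift_of q (local_lift c0 q).
Proof. by move=> qc l; rewrite scale_line ?invr_eq0 // -pick_liftP. Qed.

Lemma local_lift_chart (c0 : chart) (q : mproj) l :
  chart_domain c0 q -> local_lift c0 q l 0 (c0 l) = 1.
Proof. by move=> qc; rewrite /local_lift /normalize mxE mulVf. Qed.

(* The equation of each hypersurface, multiplied by the coordinates [g l 0 (c0 l)]
   of the factors [l] on which it does not depend, is a full multilinear form. *)
Definition equation_tensor (U : utilities) (c0 : chart) (k : family_index n) :
    profile n -> R :=
  match tagged k with
  | inl o => fun s => \prod_l eqtype.dfwith (fun l a => (a == c0 l)%:R : R)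
      (fun a : 'I_(n (tag k)).+1 => hyp_form o (delta_mx 0 a : 'rV[R]__)) l (s l)
  | inr jk => fun s => (s (tag k) == c0 (tag k))%:R *
      lam_tensor U (existT _ (tag k) jk) s
  end.

Lemma equation_tensor_hyp U c0 i (o : option 'I_(n i).+1) (g : mixed) :
  mform (equation_tensor U c0 (existT _ i (inl o))) g =
    hyp_form o (g i) * \prod_(l | l != i) g l 0 (c0 l).
Proof.
rewrite mform_prod /= (bigD1 i) //= eqtype.dfwith_in -hyp_form_coefE; congr (_ * _).
apply: eq_bigr => l li; rewrite eqtype.dfwith_out 1?eq_sym //.
rewrite (bigD1 (c0 l)) //= eqxx mulr1 big1 ?addr0 // => a /negbTE ->.
by rewrite mulr0.
Qed.

Lemma equation_tensor_diff U c0 i (jk : 'I_(n i).+1 * 'I_(n i).+1) (g : mixed) :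
  mform (equation_tensor U c0 (existT _ i (inr jk))) g =
    g i 0 (c0 i) * Lam U (existT _ i jk) g.
Proof. exact: (Lam_coord U (r := existT _ i jk)). Qed.

(** Regularity is applied to the members through [p]. As their equations vanish at [p], the
    auxiliary coordinate factors in [equation_tensor] drop out of the differentials. *)
Lemma family_local_transversality (U : utilities)
    (T : forall i : 'I_m, {set option 'I_(n i).+1})
    (E : forall i : 'I_m, {set 'I_(n i).+1 * 'I_(n i).+1}) (p : mproj) :
  regular U -> (forall i jk, jk \in E i -> jk.1 != jk.2) ->
  solvable_edges R (finset.finset (fun r : edge n => tagged r \in E (tag r))) ->
  exists (O : set mproj) (F : family_index n -> mproj -> 'rV[R]_1),
    (forall k, family_members T E k -> hypersurface_family U k p ->
       defining_map (@mproj_param R m n) (hypersurface_family U k) p O (F k)) /\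
    (forall c x, mproj_param c x = p -> forall y : family_index n -> 'rV[R]_1,
       exists v, forall k, family_members T E k -> hypersurface_family U k p ->
         'd (F k \o mproj_param c) x v = y k).
Proof.
move=> regU Ene solvE; have [c0 pc0] := exists_chart p.
have HE k : family_members T E k -> forall q, chart_domain c0 q ->
    hypersurface_family U k q <->
    mform (equation_tensor U c0 k) (local_lift c0 q) = 0.
  case: k => i [a|[j k]] Pk q qc; have ql := local_lift_lift qc.
    rewrite equation_tensor_hyp big1 ?mulr1 => [|l _]; last exact: local_lift_chart.
    exact: H_hypE.
  rewrite equation_tensor_diff local_lift_chart // mul1r.
  by apply: H_diffE => //; exact: Ene Pk.
apply: (local_transversality hm (c0 := c0) (tau := equation_tensor U c0)) => //.
  by move=> k Pk _; exact: HE.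
move=> y; set G := local_lift c0 p.
have pG : lift_of p G by exact: local_lift_lift.
have G1 l : G l 0 (c0 l) = 1 by exact: local_lift_chart.
pose T' i := finset.finset (fun o => (o \in T i) && (hyp_form o (G i) == 0)).
pose Rs := finset.finset (fun r : edge n => (tagged r \in E (tag r)) && (Lam U r G == 0)).
have [] := regU T' Rs G _ (lift_neq0 pG) _ _ (fun i o => y (existT _ i (inl o)))
    (fun r => y (existT _ (tag r) (inr (tagged r)))).
- move=> i z; have [u uP] := solvE i z; exists u => jk jkRs; apply: uP.
  by move: jkRs; rewrite !inE => /andP[].
- by move=> i o; rewrite inE => /andP[_ /eqP].
- by move=> r; rewrite inE => /andP[_ /eqP].
move=> w [wT wR]; exists w; case=> i [a | jk] Pk /(HE _ Pk _ pc0).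
  rewrite equation_tensor_hyp big1 ?mulr1 => [Ho|l _]; last exact: G1.
  rewrite -(wT i a); last by rewrite inE Ho eqxx andbT; exact: Pk.
  rewrite (bigD1 i) //= [X in _ + X]big1 => [|l li].
    rewrite addr0 equation_tensor_hyp setf_in big1 ?mulr1 // => l li.
    by rewrite setf_out.
  by rewrite equation_tensor_hyp setf_out 1?eq_sym // Ho mul0r.
rewrite equation_tensor_diff G1 mul1r => HL.
rewrite -(wR (existT _ i jk)); last by rewrite inE HL eqxx andbT; exact: Pk.
rewrite (bigD1 i) //= equation_tensor_diff.
rewrite (@Lam_setf_tag _ _ _ U (existT _ i jk)) HL mulr0 add0r.
apply: eq_bigr => l li.
by rewrite equation_tensor_diff setf_out 1?eq_sym // G1 mul1r.
Qed.

End Families.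

Theorem theorem3p1 (R : realType) (m : nat) (hm : (0 < m)%N)
    (n : 'I_m -> nat) (hn : forall i, (0 < n i)%N) :
  exists D : set (utilities R n),
    [/\ semialgebraic D, lebesgue_null D &
    forall U : utilities R n, ~ D U ->
      [/\ (forall (i : 'I_m) (j : option 'I_(n i).+1),
             smooth_hypersurface (@mproj_param R m n) (@H_hyp R m n i j)),
          (forall (i : 'I_m) (j k : 'I_(n i).+1), (j < k)%N ->
             smooth_hypersurface (@mproj_param R m n) (@H_diff R m n U i j k)) &
          (forall (T : forall i : 'I_m, {set option 'I_(n i).+1})
                  (E : forall i : 'I_m, {set 'I_(n i).+1 * 'I_(n i).+1}),
             (forall i jk, jk \in E i -> (jk.1 < jk.2)%N) ->
             (forall i, union_of_trees (E i)) ->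
             everywhere_transversal (@mproj_param R m n)
               (family_members T E) (@hypersurface_family R m n U))]].
Proof.
have [Q Q0 Qreg] := exists_regular R n.
exists [set U : utilities R n | peval Q U = 0]; split.
- exists [:: ([:: Q], [::])]; apply/funext => U; apply/propext => /=.
  by rewrite !andbT orbF; split=> [/eqP|/eqP].
- by apply: lebesgue_null_zeros Q0; exact: (Ordinal hm, [ffun=> ord0]).
move=> U /eqP/Qreg regU; split=> [i o p Hp|i j k jk p Hp|T E Elt treeE p].
- have [||O [F [FP _]]] := @family_local_transversality _ _ _ hm hn U
    (fun=> finset.setT) (fun=> finset.set0) p regU.
  + by move=> i' jk; rewrite inE.
  + by move=> i' y; exists (fun=> 0) => jk; rewrite !inE.
  exists O, (F (existT _ i (inl o))); apply: FP => //.
  by rewrite /family_members /= inE.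
- have jk' : j != k by apply: contraTneq jk => ->; rewrite ltnn.
  (* The hyperplanes could be treated all at once, but here the family has a single edge: the graph
     of all pairs is in general not a forest. *)
  have [||O [F [FP _]]] := @family_local_transversality _ _ _ hm hn U
    (fun=> finset.set0) (fun i' => finset.finset (fun a : 'I_(n i').+1 * 'I_(n i').+1 =>
      (existT _ i' a : edge n) == existT _ i (j, k))) p regU.
  + move=> i' a; rewrite inE => /eqP E.
    by have /= -> := congr1 (fun r : edge n => (tagged r).1 != (tagged r).2) E.
  + move=> i' y; have [u uP] := solvable_edges1 jk' y; exists u => a.
    by rewrite !inE => aE; apply: uP; rewrite inE.
  exists O, (F (existT _ i (inr (j, k)))); apply: FP => //.
  by rewrite /family_members /= inE.
right; have [||O [F [FP dF]]] := @family_local_transversality _ _ _ hm hn U T E p regU.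
- by move=> i jk /Elt; apply: contraTneq => ->; rewrite ltnn.
- move=> i y; have [|u uP] := union_of_trees_potential y _ (treeE i).
    move=> j k /Elt /= jk; apply/negP => /Elt /= kj.
    by have := ltn_trans jk kj; rewrite ltnn.
  by exists u => -[j k]; rewrite inE; exact: uP.
by exists O, (fun=> 1%N), F.
Qed.
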